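(* Let $n\ge2$ and $m\in\mathbb{Z}$. Let $x=x_1\cdots x_n$, $\delta=(n-1,n-2,\dots,1,0)$, $x^\delta=x_1^{n-1}x_2^{n-2}\cdots x_{n-1}$, and \[ g_{m,n}(z,q):=x^{-m}\prod_{\substack{i,j=1\\ i\ne j}}^n\frac{(qx_ix_j^{-1};q)_\infty}{(zx_ix_j^{-1};q)_\infty}\prod_{1\le i<j\le n}(x_i-x_j). \] Let $A_{1,m,n}(z,q)$ be the coefficient of $x^\delta x_1^{-nm}$ in $g_{m,n}(z,q)$. Then \[ A_{1,m,n}(z,q)=(-1)^{(n-1)m}q^{(n-1)m(m-1)/2}\frac{(z;q)_\infty^{n-1}}{(q;q)_\infty^{n-2}(qz^{n-1};q)_\infty(z;z)_{n-1}}\prod_{i=1}^{n-1}\frac{(z^iq^{1-m},z^iq^m;q)_\infty}{(z^{i+1},z^{i-1}q;q)_\infty}. \]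
   Context: $q,z$ are indeterminates (with $|q|<1$, $|z|<1$); $(a;q)_\infty=\prod_{k\ge0}(1-aq^k)$, $(a;q)_n=\prod_{k=0}^{n-1}(1-aq^k)$, $(a_1,\dots,a_r;q)_\infty=\prod_i(a_i;q)_\infty$. The products are expanded as formal power series in $z$ and $q$ whose coefficients are Laurent polynomials in $x_1,\dots,x_n$, and coefficients are extracted coefficientwise. *)

(* Defs.v *)
(* Formal series in z, q with Laurent-polynomial
   coefficients in x_1..x_n are handled through explicit finite
   approximants (truncated infinite products / truncated geometric
   series for the inverses), and "coefficient of a monomial in the
   formal series" is the eventually-constant value of that coefficient
   in the approximants. *)
From mathcomp Require Import all_boot all_order all_algebra.
Set Implicit Arguments. Unset Strict Implicit. Unset Printing Implicit Defensive.
Import Order.TTheory GRing.Theory Num.Theory.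
Local Open Scope ring_scope.

(* Exponent of a Laurent monomial  z^a q^b x_1^{e_1} ... x_n^{e_n}
   (variables x_1..x_n are indexed by 'I_n, x_1 being index 0). *)
Definition expo (n : nat) := (int * int * {ffun 'I_n -> int})%type.

Definition eadd n (e f : expo n) : expo n :=
  (e.1.1 + f.1.1, e.1.2 + f.1.2, [ffun i => e.2 i + f.2 i]).

Definition escale n (k : nat) (e : expo n) : expo n :=
  (e.1.1 *+ k, e.1.2 *+ k, [ffun i => e.2 i *+ k]).

Definition ezero n : expo n := (0, 0, [ffun=> 0]).

(* A finite formal Z-linear combination of Laurent monomials
   (Laurent polynomial in z, q, x_1..x_n), as a list of terms. *)
Definition lpoly (n : nat) := seq (int * expo n).

Definition lcoef n (p : lpoly n) (mu : expo n) : int :=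
  \sum_(t <- p | t.2 == mu) t.1.

Definition lmon n (c : int) (e : expo n) : lpoly n := [:: (c, e)].
Definition lone n : lpoly n := lmon 1 (ezero n).
Definition ladd n (p r : lpoly n) : lpoly n := p ++ r.
Definition lmul n (p r : lpoly n) : lpoly n :=
  [seq (s.1 * t.1, eadd s.2 t.2) | s <- p, t <- r].
Definition lprod n (ps : seq (lpoly n)) : lpoly n := foldr (@lmul n) (lone n) ps.
Definition lsum n (ps : seq (lpoly n)) : lpoly n := flatten ps.

Definition one_minus n (w : expo n) : lpoly n := ladd (lone n) (lmon (-1) w).

Definition poch n (u base : expo n) (K : nat) : lpoly n :=
  lprod [seq one_minus (eadd u (escale k base)) | k <- iota 0 K].

(* truncation at N of 1/(1-w) = sum_{j<N} w^j *)
Definition geom n (w : expo n) (N : nat) : lpoly n :=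
  lsum [seq lmon 1 (escale j w) | j <- iota 0 N].

Definition ipoch n (u base : expo n) (K N : nat) : lpoly n :=
  lprod [seq geom (eadd u (escale k base)) N | k <- iota 0 K].

Definition coef_lim n (F : nat -> lpoly n) (mu : expo n) (c : int) : Prop :=
  exists N0 : nat, forall N : nat, (N0 <= N)%N -> lcoef (F N) mu = c.

Definition xexp n (f : {ffun 'I_n -> int}) : expo n := (0, 0, f).
Definition zq n (a b : int) : expo n := (a, b, [ffun=> 0]).
Definition xi n (i : 'I_n) : {ffun 'I_n -> int} := [ffun k => (k == i)%:Z].
Definition xij n (i j : 'I_n) : {ffun 'I_n -> int} :=
  [ffun k => (k == i)%:Z - (k == j)%:Z].

Definition qb n : expo n := zq n 0 1.

Definition offdiag_pairs n : seq ('I_n * 'I_n) :=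
  [seq p <- [seq (i, j) | i <- enum 'I_n, j <- enum 'I_n] | (p : 'I_n * 'I_n).1 != p.2].
Definition lt_pairs n : seq ('I_n * 'I_n) :=
  [seq p <- [seq (i, j) | i <- enum 'I_n, j <- enum 'I_n] | ((p : 'I_n * 'I_n).1 < p.2)%N].

Definition g_approx (n : nat) (m : int) (N : nat) : lpoly n :=
  lprod [:: lmon 1 (xexp [ffun=> - m]);
            lprod [seq poch (0, 1, xij p.1 p.2) (qb n) N | p <- offdiag_pairs n];
            lprod [seq ipoch (1, 0, xij p.1 p.2) (qb n) N N | p <- offdiag_pairs n];
            lprod [seq ladd (lmon 1 (xexp (xi p.1))) (lmon (-1) (xexp (xi p.2)))
                  | p <- lt_pairs n] ].

Definition target_x (n : nat) (m : int) : {ffun 'I_n -> int} :=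
  [ffun k : 'I_n => ((n.-1 - k)%N)%:Z - (val k == 0%N)%:Z * (n%:Z * m)].

Definition rhs_approx (n : nat) (m : int) (N : nat) : lpoly n :=
  lprod [:: lmon ((-1) ^ ((n.-1)%:Z * m))
                 (zq n 0 (divz ((n.-1)%:Z * m * (m - 1)) 2));
            lprod (nseq n.-1 (poch (zq n 1 0) (qb n) N));
            lprod (nseq (n - 2) (ipoch (qb n) (qb n) N N));
            ipoch (zq n (n.-1)%:Z 1) (qb n) N N;
            ipoch (zq n 1 0) (zq n 1 0) n.-1 N;
            lprod [seq lprod [:: poch (zq n i%:Z (1 - m)) (qb n) N;
                                 poch (zq n i%:Z m) (qb n) N;
                                 ipoch (zq n i.+1%:Z 0) (qb n) N N;
                                 ipoch (zq n i.-1%:Z 1) (qb n) N N]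
                  | i <- iota 1 n.-1] ].

(* Main.v *)
(* A power series in z whose coefficients are Laurent series in q
   is determined by its values at z = q^k for all large k, where g becomes,
   up to a power of x_1 ... x_n, the antisymmetric polynomial
   Psi = prod_{i<j} (x_i - x_j) prod_{0<l<k} (x_j - q^l x_i)(x_i - q^l x_j).
   Coefficient extraction is covariant under x_i -> q x_i (i in I); taking
   I = {1} + S for every subset S of {2, .., n} and summing with suitable
   weights yields two determinants that are triangular in a Vandermonde basis.
   Comparing them gives a two-term recursion in m for the coefficient A_m.  At
   m = k the exponent of x_1 is extremal, so that setting x_1 = 0 expresses A_k
   through A_0 for n - 1 variables, and induction on n evaluates everything. *)
Require Import Defs.
From HB Require Import structures.
From mathcomp Require Import all_boot all_order all_algebra.
From mathcomp Require Import all_fingroup fraction mpoly ring zify.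
Set Implicit Arguments. Unset Strict Implicit. Unset Printing Implicit Defensive.
Import Order.TTheory GRing.Theory Num.Theory.
Local Open Scope ring_scope.

(** * Weighted sums of Vandermonde determinants *)

(** The q-shift multiplies Psi by a rational function, and clearing its denominator leaves the
    coefficient of a product with the extra factor prod (x_1 - z x_i), which is not one of the A_m.
    A single weighted sum over S therefore does not close up; two sums involving the same unknown
    coefficient are compared and the unknown is eliminated. One sum collapses to x_1^(n-1) times a
    Vandermonde determinant, the other to x_2 ... x_n times it; dividing by these monomials leads to
    the exponents of A_(m+1) and of A_m. By antisymmetry the remaining Vandermonde factor only
    contributes (n-1)!. The recursion has order one and needs one starting value per n. It runs from
    m = k downwards, and its value at m = 0 starts the next number of variables, so the closed form
    for all m and the case m = 0 are proved in alternation. Infinite products never occur: for fixed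
    k the approximants are compared with one polynomial modulo powers of q. *)

Definition vdm (A : comPzRingType) N (v : 'I_N -> A) : A :=
  \prod_(i < N) \prod_(j < N | (i < j)%N) (v j - v i).

Lemma vdmE (A : comPzRingType) N (v : 'I_N -> A) :
  vdm v = \det (\matrix_(p < N, i < N) v i ^+ p).
Proof.
have -> : \matrix_(p < N, i < N) v i ^+ p = Vandermonde N (\row_i v i).
  by apply/matrixP=> p i; rewrite !mxE.
rewrite det_Vandermonde; apply: eq_bigr => i _; apply: eq_bigr => j _.
by rewrite !mxE.
Qed.

(** Multilinearity of the determinant: every column is a sum of two columns, and [S] records where
    the first one is chosen. *)
Lemma sum_subset_vdm (A : comPzRingType) N (u v a b : 'I_N -> A) :
  \sum_(S : {set 'I_N}) (\prod_i (if i \in S then u i else v i)) *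
     vdm (fun i => if i \in S then a i else b i) =
  \det (\matrix_(p < N, i < N) (u i * a i ^+ p + v i * b i ^+ p)).
Proof.
rewrite -det_tr /determinant.
under [RHS]eq_bigr => s _.
  under eq_bigr => i _ do rewrite !mxE.
  rewrite bigA_distr mulr_sumr; over.
rewrite exchange_big /=; apply: eq_bigr => S _.
rewrite vdmE -det_tr /determinant mulr_sumr; apply: eq_bigr => s _.
rewrite mulrCA -big_split /=; congr (_ * _); apply: eq_bigr => i _.
by rewrite !mxE; case: ifP.
Qed.

(** The matrix is an upper bidiagonal matrix times the Vandermonde matrix; [b N.-1 = 0] keeps the
    power [x i ^+ N], absent from the latter, out of the last row. *)
Lemma det_bidiag_up (A : comPzRingType) N (x : 'I_N -> A) (a b : nat -> A) :
  b N.-1 = 0 ->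
  \det (\matrix_(p < N, i < N) (a p * x i ^+ p - b p * x i ^+ p.+1)) =
  (\prod_(p < N) a p) * vdm x.
Proof.
move=> b0.
pose L := \matrix_(p < N, p' < N)
  (if p == p' then a p else if p.+1 == p' :> nat then - b p else 0).
have -> : \matrix_(p < N, i < N) (a p * x i ^+ p - b p * x i ^+ p.+1) =
          L *m \matrix_(p < N, i < N) x i ^+ p.
  apply/matrixP=> p i; rewrite !mxE (bigD1 p) //= !mxE eqxx; congr (_ + _).
  case: (ltnP p.+1 N) => [lt|ge].
    rewrite (bigD1 (Ordinal lt)) /=; last by rewrite -val_eqE /= neq_ltn ltnSn orbT.
    rewrite !mxE -val_eqE /= eqxx (ltn_eqF (ltnSn p)) big1 ?addr0 ?mulNr // => j.
    rewrite -!val_eqE /= => /andP[/negPf jp /negPf jp1].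
    by rewrite !mxE -val_eqE /= eq_sym jp eq_sym jp1 mul0r.
  have -> : b p = 0.
    by rewrite -b0; congr b; have := ltn_ord p; lia.
  rewrite mul0r oppr0 big1 // => j; rewrite -!val_eqE /= => /negPf jp.
  rewrite !mxE -val_eqE /= eq_sym jp; case: eqP => [e|]; last by rewrite mul0r.
  by have := ltn_ord j; rewrite -e ltnNge ge.
rewrite det_mulmx vdmE; congr (_ * _).
rewrite -det_tr det_trig.
  by apply: eq_bigr => p _; rewrite !mxE eqxx.
apply/is_trig_mxP => i j lij; rewrite !mxE -val_eqE /=.
by case: eqP => [e|_]; [lia | case: eqP => // e; lia].
Qed.

Lemma det_scale_rows (A : comPzRingType) N (a x : 'I_N -> A) :
  \det (\matrix_(p < N, i < N) (a p * x i ^+ p)) = (\prod_(p < N) a p) * vdm x.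
Proof.
rewrite vdmE.
have -> : \matrix_(p < N, i < N) (a p * x i ^+ p) =
   diag_mx (\row_p a p) *m \matrix_(p < N, i < N) x i ^+ p.
  by apply/matrixP=> p i; rewrite mul_diag_mx !mxE.
by rewrite det_mulmx det_diag; congr (_ * _); apply: eq_bigr => p _; rewrite !mxE.
Qed.

(** Once [x i] is taken out of every column, the left factor is lower bidiagonal; [a 0 = 0] keeps
    the power -1 out of the first row. *)
Lemma det_bidiag_low (A : comPzRingType) N (x : 'I_N -> A) (a b : nat -> A) :
  a 0 = 0 ->
  \det (\matrix_(p < N, i < N) (a p * x i ^+ p - b p * x i ^+ p.+1)) =
  (\prod_(p < N) - b p) * (\prod_i x i) * vdm x.
Proof.
move=> a0.
pose L := \matrix_(p < N, p' < N)
  (if p == p' then - b p else if p == p'.+1 :> nat then a p else 0).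
have -> : \matrix_(p < N, i < N) (a p * x i ^+ p - b p * x i ^+ p.+1) =
          L *m \matrix_(p < N, i < N) x i ^+ p *m diag_mx (\row_i x i).
  apply/matrixP=> p i; rewrite mul_mx_diag !mxE (bigD1 p) //= !mxE eqxx.
  rewrite mulrDl addrC mulNr mulNr exprSr mulrA; congr (_ + _).
  case: (posnP p) => [p0|pgt].
    rewrite p0 a0 mul0r big1 ?mul0r // => j; rewrite -!val_eqE /= => /negPf jp.
    by rewrite !mxE -val_eqE /= eq_sym jp p0 mul0r.
  have lt : (p.-1 < N)%N by have := ltn_ord p; lia.
  rewrite (bigD1 (Ordinal lt)) /=; last by rewrite -val_eqE /=; lia.
  rewrite !mxE -val_eqE /= prednK // eqxx big1 ?addr0.
    have -> : (p == p.-1 :> nat) = false by lia.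
    by rewrite -mulrA -exprSr prednK.
  move=> j; rewrite -!val_eqE /= => /andP[/negPf jp /negPf jp1].
  rewrite !mxE -val_eqE /= eq_sym jp; case: eqP => [e|]; last by rewrite mul0r.
  by rewrite e /= eqxx in jp1.
have -> : \prod_(p < N) - b p = \det L.
  rewrite det_trig; first by apply: eq_bigr => p _; rewrite !mxE eqxx.
  apply/is_trig_mxP => i j lij; rewrite !mxE -val_eqE /=.
  by case: eqP => [e|_]; [lia | case: eqP => // e; lia].
rewrite !det_mulmx vdmE det_diag mulrAC; congr (_ * _ * _).
by apply: eq_bigr => p _; rewrite !mxE.
Qed.

Lemma sum_vdm_P0 (A : comPzRingType) N (x : 'I_N -> A) (z l1 l2 : A) :
  \sum_(S : {set 'I_N}) (\prod_i (if i \in S then l2 else l1)) *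
     vdm (fun i => if i \in S then x i else z * x i) =
  (\prod_(p < N) (l2 + l1 * z ^+ p)) * vdm x.
Proof.
rewrite sum_subset_vdm -det_scale_rows; congr (\det _).
by apply/matrixP=> p i; rewrite !mxE exprMn; ring.
Qed.

(* The weight of the complement of S is chosen so that the top-degree entry of
   the last row vanishes (here), or the lowest one of the first row (below). *)
Lemma sum_vdm_top (A : comPzRingType) N (x : 'I_N -> A) (y z : A) :
  \sum_(S : {set 'I_N})
     (\prod_i (if i \in S then z * (y - z * x i) else - z ^+ N.+1 * (z * y - x i))) *
     vdm (fun i => if i \in S then z * x i else x i) =
  (\prod_(p < N) (z ^+ p.+1 - z ^+ N.+2)) * y ^+ N * vdm x.
Proof.
rewrite sum_subset_vdm.
pose a p := (z ^+ p.+1 - z ^+ N.+2) * y.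
pose b p := if (p < N.-1)%N then z ^+ p.+2 - z ^+ N.+1 else 0.
transitivity (\det (\matrix_(p < N, i < N) (a p * x i ^+ p - b p * x i ^+ p.+1))).
  congr (\det _); apply/matrixP=> p i; rewrite !mxE.
  have -> : b p = z ^+ p.+2 - z ^+ N.+1.
    rewrite /b; case: ltnP => // h; have -> : p.+2 = N.+1 by have := ltn_ord p; lia.
    by rewrite subrr.
  by rewrite /a exprMn !exprS; ring.
rewrite det_bidiag_up ?big_split /=; last by rewrite /b ltnn.
by congr (_ * _ * _); rewrite prodr_const card_ord.
Qed.

Lemma sum_vdm_bot (A : comPzRingType) N (x : 'I_N -> A) (y z : A) :
  \sum_(S : {set 'I_N})
     (\prod_i (if i \in S then z * (y - z * x i) else - 1 * (z * y - x i))) *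
     vdm (fun i => if i \in S then z * x i else x i) =
  (\prod_(p < N) (1 - z ^+ p.+2)) * (\prod_i x i) * vdm x.
Proof.
rewrite sum_subset_vdm.
pose a p := (z ^+ p.+1 - z) * y.
pose b p := z ^+ p.+2 - 1.
transitivity (\det (\matrix_(p < N, i < N) (a p * x i ^+ p - b p * x i ^+ p.+1))).
  congr (\det _); apply/matrixP=> p i; rewrite !mxE.
  by rewrite /a /b exprMn !exprS; ring.
rewrite det_bidiag_low; last by rewrite /a expr1 subrr mul0r.
by congr (_ * _ * _); apply: eq_bigr => p _; rewrite opprB.
Qed.

(** * The q-shift *)

(** At z = q^k the quotient (q w; q)_oo / (z w; q)_oo telescopes to prod_(0 < l < k) (1 - q^l w).
    The product is taken over w = x / y and w = y / x, with denominators cleared. *)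
Definition pairf (A : comPzRingType) (q : A) k (x y : A) : A :=
  (x - y) * \prod_(l < k.-1) ((y - q ^+ l.+1 * x) * (x - q ^+ l.+1 * y)).

Lemma pairfN (A : comPzRingType) (q : A) k (x y : A) :
  pairf q k y x = - pairf q k x y.
Proof.
rewrite /pairf -mulNr opprB; congr (_ * _).
by apply: eq_bigr => l _; rewrite mulrC.
Qed.

(** Homogeneity of degree 2k - 1; the extra [q] on the left makes the exponent 2k. *)
Lemma pairf_shift2 (A : comPzRingType) (q : A) k (x y : A) : (0 < k)%N ->
  q * pairf q k (q * x) (q * y) = q ^+ k * q ^+ k * pairf q k x y.
Proof.
case: k => // k _; rewrite /pairf /=.
have -> : \prod_(l < k) ((q * y - q ^+ l.+1 * (q * x)) * (q * x - q ^+ l.+1 * (q * y)))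
   = \prod_(l < k) (q * q) * \prod_(l < k) ((y - q ^+ l.+1 * x) * (x - q ^+ l.+1 * y)).
  by rewrite -big_split /=; apply: eq_bigr => l _; ring.
by rewrite prodr_const card_ord exprMn !exprS; ring.
Qed.

(** Shifting one variable moves both products by one index, so only end factors change;
    [q * x - q ^+ k * y] is the denominator of the resulting ratio. *)
Lemma pairf_shift1 (A : comPzRingType) (q : A) k (x y : A) : (0 < k)%N ->
  pairf q k (q * x) y * (q * x - q ^+ k * y) =
  q ^+ k * pairf q k x y * (q ^+ k * x - y).
Proof.
case: k => // k _; rewrite /pairf /= !big_split /=.
have -> : \prod_(l < k) (q * x - q ^+ l.+1 * y) = q ^+ k * \prod_(l < k) (x - q ^+ l * y).
  rewrite -[X in q ^+ X]card_ord -prodr_const -big_split /=.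
  by apply: eq_bigr => l _; rewrite exprS; ring.
have e1 : (q * x - y) * \prod_(l < k) (y - q ^+ l.+1 * (q * x)) =
   (\prod_(l < k) (y - q ^+ l.+1 * x)) * (q ^+ k.+1 * x - y).
  transitivity (- \prod_(l < k.+1) (y - q ^+ l.+1 * x)).
    rewrite big_ord_recl /= -mulNr expr1 opprB; congr (_ * _).
    by apply: eq_bigr => l _; rewrite [in RHS]exprSr -mulrA.
  by rewrite big_ord_recr /= -mulrN opprB.
have e2 : (\prod_(l < k) (x - q ^+ l * y)) * (q * x - q ^+ k.+1 * y) =
    q * ((x - y) * \prod_(l < k) (x - q ^+ l.+1 * y)).
  transitivity (q * \prod_(l < k.+1) (x - q ^+ l * y)).
    by rewrite big_ord_recr /= exprS; ring.
  by rewrite big_ord_recl /= expr0 mul1r.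
transitivity (((q * x - y) * \prod_(l < k) (y - q ^+ l.+1 * (q * x))) * q ^+ k *
   ((\prod_(l < k) (x - q ^+ l * y)) * (q * x - q ^+ k.+1 * y))); first by ring.
by rewrite e1 e2 exprS; ring.
Qed.

Definition Psi (A : comPzRingType) (q : A) k n (v : 'I_n -> A) : A :=
  \prod_(i < n) \prod_(j < n | (i < j)%N) pairf q k (v i) (v j).

Lemma prod_lt_recl (A : comPzRingType) n (F : 'I_n.+1 -> 'I_n.+1 -> A) :
  \prod_(i < n.+1) \prod_(j < n.+1 | (i < j)%N) F i j =
  (\prod_(j < n) F ord0 (lift ord0 j)) *
  \prod_(i < n) \prod_(j < n | (i < j)%N) F (lift ord0 i) (lift ord0 j).
Proof.
rewrite big_ord_recl; congr (_ * _).
  by rewrite big_mkcond big_ord_recl /= mul1r; apply: eq_bigr.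
apply: eq_bigr => i _; rewrite big_mkcond big_ord_recl /= mul1r [RHS]big_mkcond.
by apply: eq_bigr.
Qed.

Definition vcons T n (y : T) (x : 'I_n -> T) (i : 'I_n.+1) : T :=
  if unlift ord0 i is Some j then x j else y.

Lemma vcons0 T n (y : T) (x : 'I_n -> T) : vcons y x ord0 = y.
Proof. by rewrite /vcons unlift_none. Qed.

Lemma vconsS T n (y : T) (x : 'I_n -> T) j : vcons y x (lift ord0 j) = x j.
Proof. by rewrite /vcons liftK. Qed.

Lemma Psi_cons (A : comPzRingType) (q : A) k n (y : A) (x : 'I_n -> A) :
  Psi q k (vcons y x) = (\prod_j pairf q k y (x j)) * Psi q k x.
Proof.
rewrite /Psi prod_lt_recl vcons0; congr (_ * _).
  by apply: eq_bigr => j _; rewrite vconsS.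
by apply: eq_bigr => i _; apply: eq_bigr => j _; rewrite !vconsS.
Qed.

(* The q-shift on the variables indexed by 1 and S: the identity holds
   factor by factor over the pairs of variables. *)
Lemma Psi_shift (A : comPzRingType) (q : A) k n (S : {set 'I_n}) (y : A)
    (x : 'I_n -> A) (z := q ^+ k) (sx := fun i => if i \in S then q * x i else x i) :
  (0 < k)%N ->
  Psi q k (vcons (q * y) sx) * (\prod_i (q * y - z * sx i)) *
    vdm (fun i => if i \in S then sx i else z * sx i) =
  (\prod_(i < n) \prod_(j < n | (i < j)%N) z) *
    (\prod_i (z * (if i \in S then z * (y - z * x i) else z * y - x i))) *
    (Psi q k (vcons y x) * vdm (fun i => if i \in S then z * x i else x i)).
Proof.
move=> k0; rewrite !Psi_cons.
set P1 := \prod_i (q * y - z * sx i).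
set F1 := \prod_j pairf q k (q * y) (sx j); set F2 := \prod_j pairf q k y (x j).
set G := \prod_i (z * _); set Z := \prod_(i < n) \prod_(j < n | _) z.
set V1 := vdm _; set V2 := vdm _.
have e1 : F1 * P1 = G * F2.
  rewrite /F1 /P1 /G /F2 -!big_split /=; apply: eq_bigr => i _; rewrite /sx.
  case: ifP => _.
    transitivity (q * pairf q k (q * y) (q * x i) * (y - z * x i)); first by ring.
    by rewrite pairf_shift2 // -/z; ring.
  by rewrite pairf_shift1 // -/z; ring.
(* When exactly one of the two indices lies in [S], the factor of [V1] is up to sign the denominator
   in [pairf_shift1], and that of [V2] the matching numerator. This dictates which variables carry
   [z] in the two determinants. *)
have e2 : Psi q k sx * V1 = Z * (Psi q k x * V2).
  rewrite /Psi /V1 /V2 /Z /vdm -!big_split /=; apply: eq_bigr => i _.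
  rewrite -!big_split /=; apply: eq_bigr => j _.
  have z1 a b : q * pairf q k (q * a) (q * b) = z * z * pairf q k a b.
    exact: pairf_shift2.
  have z2 a b : pairf q k (q * a) b * (q * a - z * b) = z * pairf q k a b * (z * a - b).
    exact: pairf_shift1.
  rewrite /sx; case: (i \in S); case: (j \in S) => /=.
  - transitivity (q * pairf q k (q * x i) (q * x j) * (x j - x i)); first by ring.
    by rewrite z1; ring.
  - transitivity (- (pairf q k (q * x i) (x j) * (q * x i - z * x j))); first by ring.
    by rewrite z2; ring.
  - rewrite pairfN [pairf q k (x i) (x j)]pairfN mulNr z2; ring.
  - by ring.
transitivity (F1 * P1 * (Psi q k sx * V1)); first by ring.
by rewrite e1 e2; ring.
Qed.

Lemma eq_Psi (A : comPzRingType) (q : A) k n (v w : 'I_n -> A) :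
  v =1 w -> Psi q k v = Psi q k w.
Proof.
by move=> e; apply: eq_bigr => i _; apply: eq_bigr => j _; rewrite !e.
Qed.

Lemma eq_vdm (A : comPzRingType) n (v w : 'I_n -> A) : v =1 w -> vdm v = vdm w.
Proof.
by move=> e; apply: eq_bigr => i _; apply: eq_bigr => j _; rewrite !e.
Qed.

Lemma rmorph_Psi (A B : comPzRingType) (f : {rmorphism A -> B}) (q : A) k n
  (v : 'I_n -> A) : f (Psi q k v) = Psi (f q) k (fun i => f (v i)).
Proof.
rewrite rmorph_prod; apply: eq_bigr => i _; rewrite rmorph_prod.
apply: eq_bigr => j _; rewrite /pairf rmorphM rmorphB rmorph_prod; congr (_ * _).
by apply: eq_bigr => l _; rewrite rmorphM !rmorphB !rmorphM rmorphXn.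
Qed.

Lemma rmorph_vdm (A B : comPzRingType) (f : {rmorphism A -> B}) n
  (v : 'I_n -> A) : f (vdm v) = vdm (fun i => f (v i)).
Proof.
rewrite rmorph_prod; apply: eq_bigr => i _; rewrite rmorph_prod.
by apply: eq_bigr => j _; rewrite rmorphB.
Qed.

(** * Coefficient extraction under rescaling of the variables *)

Definition mscale (R : comNzRingType) n (c : 'I_n -> R) : {mpoly R[n]} -> {mpoly R[n]} :=
  mmap (@mpolyC n R) (fun i => (c i)%:MP * 'X_i).

HB.instance Definition _ (R : comNzRingType) n (c : 'I_n -> R) :=
  GRing.RMorphism.copy (mscale c) (mmap (@mpolyC n R) (fun i => (c i)%:MP * 'X_i)).

Lemma mcoeff_mscale (R : comNzRingType) n (c : 'I_n -> R) (p : {mpoly R[n]}) m :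
  (mscale c p)@_m = (\prod_i c i ^+ m i) * p@_m.
Proof.
rewrite [p]mpolyE (raddf_sum (mscale c)) !(raddf_sum (mcoeff m)) mulr_sumr.
apply: eq_bigr => m' _.
rewrite /= /mscale mmapZ mmapX mcoeffCM mcoeffZ mcoeffX mulrCA; congr (_ * _).
have -> : mmap1 (fun i => (c i)%:MP * 'X_i) m' = (\prod_i c i ^+ m' i)%:MP * 'X_[m'].
  rewrite /mmap1 mpolyXE_id rmorph_prod -big_split /=; apply: eq_bigr => i _.
  by rewrite exprMn rmorphXn.
by rewrite mcoeffCM mcoeffX; case: eqP => [->|]; rewrite ?mulr0.
Qed.

Lemma mscaleX (R : comNzRingType) n (c : 'I_n -> R) i : mscale c 'X_i = (c i)%:MP * 'X_i.
Proof. by rewrite /mscale mmapX mmap1U. Qed.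

Lemma mscaleC (R : comNzRingType) n (c : 'I_n -> R) a : mscale c a%:MP = a%:MP.
Proof. by rewrite /mscale mmapC. Qed.

Definition mcons n a (e : 'I_n -> nat) : 'X_{1..n.+1} := [multinom vcons a e i | i < n.+1].

Definition PsiX (R : comNzRingType) (q : R) k n : {mpoly R[n]} :=
  Psi q%:MP k (fun i => 'X_i).

(** The shift along [S] multiplies the coefficient by q^(a + e |S|). Weighting with w^(N - |S|) and
    summing makes the right-hand side collapse by [sum_vdm_P0]. The weight [w] stays free because
    two values of it are compared later. *)
Lemma PsiX_shift_sum (R : comNzRingType) (q w : R) k N a e
    (z := q ^+ k) (x := fun i : 'I_N => 'X_(lift ord0 i) : {mpoly R[N.+1]})
    (y := 'X_ord0 : {mpoly R[N.+1]}) (s := mcons a (fun=> e)) :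
  (0 < k)%N ->
  (\prod_(i < N) \prod_(j < N | (i < j)%N) z) * z ^+ N *
  (PsiX q k N.+1 * \sum_(S : {set 'I_N})
     (\prod_i (if i \in S then z%:MP * (y - z%:MP * x i) else w%:MP * (z%:MP * y - x i))) *
     vdm (fun i => if i \in S then z%:MP * x i else x i))@_s =
  q ^+ a * (\prod_(p < N) (q ^+ e + w * z ^+ p)) *
  (PsiX q k N.+1 * (\prod_i (y - z%:MP * x i)) * vdm x)@_s.
Proof.
move=> k0.
pose D (S : {set 'I_N}) := vdm (fun i => if i \in S then x i else z%:MP * x i).
pose P0 := \prod_i (y - z%:MP * x i).
have XE : (fun i => 'X_i) =1 vcons y x.
  by move=> i; rewrite /vcons; case: unliftP => [j ->|->].
(* One subset: scaling x_1 and the variables in [S] by q acts on the coefficient as a power of q,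
   and on the polynomial through [Psi_shift]. *)
have shiftS (S : {set 'I_N}) : (\prod_(i < N) \prod_(j < N | (i < j)%N) z) *
    (PsiX q k N.+1 * ((\prod_i (z%:MP * (if i \in S then z%:MP * (y - z%:MP * x i)
     else z%:MP * y - x i))) * vdm (fun i => if i \in S then z%:MP * x i else x i)))@_s =
   q ^+ a * (\prod_(i < N) (if i \in S then q ^+ e else 1)) * (PsiX q k N.+1 * P0 * D S)@_s.
  pose c := vcons q (fun i => if i \in S then q else 1).
  have -> : q ^+ a * (\prod_(i < N) (if i \in S then q ^+ e else 1)) = \prod_i c i ^+ s i.
    rewrite big_ord_recl /c /s mnmE !vcons0; congr (_ * _).
    apply: eq_bigr => i _; rewrite mnmE !vconsS; case: ifP => _ //.
    by rewrite expr1n.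
  rewrite -mcoeff_mscale !(rmorphM (mscale c)) /=.
  have -> : mscale c (PsiX q k N.+1) =
      Psi q%:MP k (vcons (q%:MP * y) (fun i => if i \in S then q%:MP * x i else x i)).
    rewrite /PsiX (rmorph_Psi (mscale c)) /= mscaleC; apply: eq_Psi => i /=; rewrite mscaleX /c.
    rewrite /vcons; case: unliftP => [j ->|-> //].
    by case: ifP => _ //; rewrite mpolyC1 mul1r.
  have cx i : mscale c (x i) = if i \in S then q%:MP * x i else x i.
    by rewrite mscaleX /c vconsS; case: ifP => _ //; rewrite mpolyC1 mul1r.
  have -> : mscale c P0 = \prod_i (q%:MP * y - (q%:MP ^+ k) * (if i \in S then q%:MP * x i else x i)).
    rewrite /P0 (rmorph_prod (mscale c)); apply: eq_bigr => i _.
    by rewrite (rmorphB (mscale c)) (rmorphM (mscale c)) /= mscaleC cx mscaleX /c vcons0 /z rmorphXn.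
  have -> : mscale c (D S) = vdm (fun i => if i \in S then
      (if i \in S then q%:MP * x i else x i) else
      q%:MP ^+ k * (if i \in S then q%:MP * x i else x i)).
    rewrite (rmorph_vdm (mscale c)); apply: eq_vdm => i /=; rewrite -[in RHS]cx.
    by case: ifP => _ //; rewrite (rmorphM (mscale c)) /= mscaleC /z rmorphXn.
  rewrite Psi_shift // -rmorphXn -/z -mcoeffCM; congr (mcoeff s _).
  have -> : (\prod_(i < N) \prod_(j < N | (i < j)%N) z)%:MP =
     \prod_(i < N) \prod_(j < N | (i < j)%N) z%:MP :> {mpoly R[N.+1]}.
    by rewrite rmorph_prod; apply: eq_bigr => i _; rewrite rmorph_prod.
  rewrite /PsiX (eq_Psi _ _ XE); ring.
pose W (S : {set 'I_N}) := \prod_(i < N) (if i \in S then 1 else w).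
rewrite -mulrA -mcoeffCM mulr_sumr mulr_sumr !(raddf_sum (mcoeff s)) mulr_sumr /=.
rewrite -[RHS]mulrA -/P0.
have -> : (\prod_(p < N) (q ^+ e + w * z ^+ p)) * (PsiX q k N.+1 * P0 * vdm x)@_s =
   \sum_(S : {set 'I_N}) (\prod_i (if i \in S then q ^+ e else w)) * (PsiX q k N.+1 * P0 * D S)@_s.
  rewrite -mcoeffCM mulrCA.
  have -> : (\prod_(p < N) (q ^+ e + w * z ^+ p))%:MP * vdm x = \sum_(S : {set 'I_N})
     (\prod_i (if i \in S then (q ^+ e)%:MP else w%:MP)) * D S.
    rewrite /D sum_vdm_P0; congr (_ * _); rewrite rmorph_prod; apply: eq_bigr => p _.
    by rewrite rmorphD rmorphM; congr (_ + _ * _); rewrite rmorphXn.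
  rewrite mulr_sumr (raddf_sum (mcoeff s)); apply: eq_bigr => S _.
  rewrite mulrCA -mcoeffCM; congr (mcoeff s (_ * _)).
  by rewrite rmorph_prod; apply: eq_bigr => i _; case: ifP.
rewrite mulr_sumr; apply: eq_bigr => S _.
transitivity (W S * (q ^+ a * (\prod_(i < N) (if i \in S then q ^+ e else 1)) *
    (PsiX q k N.+1 * P0 * D S)@_s)); last first.
  have -> : \prod_(i < N) (if i \in S then q ^+ e else w) =
      W S * \prod_(i < N) (if i \in S then q ^+ e else 1).
    rewrite /W -big_split; apply: eq_bigr => i _.
    by case: ifP => _ /=; rewrite ?mul1r ?mulr1.
  ring.
rewrite -shiftS -!mcoeffCM; congr (mcoeff s _).
have -> : (W S)%:MP = \prod_(i < N) (if i \in S then 1 else w%:MP) :> {mpoly R[N.+1]}.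
  by rewrite rmorph_prod; apply: eq_bigr => i _; case: ifP.
rewrite [RHS]mulrCA; congr (_ * _); rewrite mulrCA [RHS]mulrCA; congr (_ * _).
have -> : (z ^+ N)%:MP = \prod_(i < N) z%:MP :> {mpoly R[N.+1]}.
  by rewrite prodr_const card_ord rmorphXn.
rewrite !mulrA; congr (_ * _).
rewrite -!big_split; apply: eq_bigr => i _ /=; case: ifP => _; ring.
Qed.

(** * Antisymmetry *)

Lemma vdm_perm (A : comPzRingType) n (s : 'S_n) (v : 'I_n -> A) :
  vdm (fun i => v (s i)) = (-1) ^+ s * vdm v.
Proof.
rewrite !vdmE mulrC -odd_permV -det_perm -det_mulmx -col_permE.
by congr (\det _); apply/matrixP => i j; rewrite !mxE.
Qed.

Lemma prod_ltgt (A : comPzRingType) n (h : 'I_n -> 'I_n -> A) :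
  \prod_(i < n) \prod_(j < n | (i < j)%N) (h i j * h j i) =
  \prod_(i < n) \prod_(j < n | j != i) h i j.
Proof.
under eq_bigr do rewrite big_split.
rewrite big_split /=.
rewrite [X in _ * X](exchange_big_dep predT) //= -big_split /=.
apply: eq_bigr => i _; rewrite [RHS](bigID (fun j : 'I_n => (i < j)%N)) /=.
congr (_ * _); apply: eq_bigl => j; rewrite -val_eqE /=; lia.
Qed.

Lemma mcoeffMX0 (R : comNzRingType) n (p : {mpoly R[n.+1]}) N a e :
  (p * 'X_ord0 ^+ N)@_(mcons (N + a) e) = p@_(mcons a e).
Proof.
rewrite mpolyXn -(mcoeffMX p (U_(ord0) *+ N)%MM); congr (mcoeff _ _).
apply/mnmP => i; rewrite mnmDE mulmnE mnm1E !mnmE /vcons.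
case: unliftP => [j ->|->]; last by rewrite eqxx mul1n.
by rewrite (negPf (neq_lift _ _)).
Qed.

Lemma mcoeffMXs (R : comNzRingType) n (p : {mpoly R[n.+1]}) a b e :
  (p * \prod_i 'X_(lift ord0 i) ^+ (b i))@_(mcons a (fun i => b i + e i)%N) = p@_(mcons a e).
Proof.
have -> : \prod_i 'X_(lift ord0 i) ^+ (b i) = 'X_[mcons 0 b] :> {mpoly R[n.+1]}.
  rewrite mpolyXE_id big_ord_recl mnmE vcons0 mul1r.
  by apply: eq_bigr => i _; rewrite mnmE vconsS.
rewrite -(mcoeffMX p (mcons 0 b)); congr (mcoeff _ _).
apply/mnmP => i; rewrite mnmDE !mnmE /vcons.
by case: unliftP.
Qed.

(** Up to a constant sign, [Psi] is the Vandermonde product times a product over all ordered pairs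
    of distinct indices, and the latter is symmetric. *)
Lemma Psi_perm (A : comPzRingType) (q : A) k n (s : 'S_n) (v : 'I_n -> A) :
  Psi q k (fun i => v (s i)) = (-1) ^+ s * Psi q k v.
Proof.
pose h (w : 'I_n -> A) i j := \prod_(l < k.-1) (w j - q ^+ l.+1 * w i).
have PsiE w : Psi q k w = (\prod_(i < n) \prod_(j < n | (i < j)%N) (-1)) * vdm w *
    \prod_(i < n) \prod_(j < n | j != i) h w i j.
  rewrite -prod_ltgt /Psi /vdm -!big_split; apply: eq_bigr => i _ /=.
  rewrite -!big_split; apply: eq_bigr => j _ /=.
  by rewrite mulN1r opprB /h -big_split.
rewrite !PsiE vdm_perm.
have -> : \prod_(i < n) \prod_(j < n | j != i) h (fun i => v (s i)) i j =
          \prod_(i < n) \prod_(j < n | j != i) h v i j.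
  rewrite [RHS](reindex_inj (@perm_inj _ s)); apply: eq_bigr => i _ /=.
  rewrite [RHS](reindex_inj (@perm_inj _ s)); apply: eq_bigl => j /=.
  by rewrite (inj_eq perm_inj).
by rewrite mulrCA -!mulrA.
Qed.

Lemma mcoeff_PsiX_perm (R : comNzRingType) (q : R) k n (s : 'S_n) (m : 'X_{1..n}) :
  (PsiX q k n)@_[multinom m (s i) | i < n] = (-1) ^+ s * (PsiX q k n)@_m.
Proof.
rewrite -mcoeff_sym /PsiX (rmorph_Psi (msym s)) /=.
have -> : Psi (msym s q%:MP) k (fun i => msym s 'X_i) =
    Psi q%:MP k (fun i : 'I_n => 'X_(s i)).
  rewrite {1}/msym mmapC; apply: eq_Psi => i.
  by rewrite /msym mmapX mmap1U.
rewrite (Psi_perm _ _ s (fun i => 'X_i : {mpoly R[n]})) -signr_odd; case: (odd_perm s); rewrite ?expr1 ?expr0.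
  by rewrite !mulN1r mcoeffN.
by rewrite !mul1r.
Qed.

(* By antisymmetry each of the N! terms of the Vandermonde determinant
   contributes the same coefficient. *)
Lemma mcoeff_PsiX_vdm (R : comNzRingType) (q : R) k N a b : (N <= b.+1)%N ->
  (PsiX q k N.+1 * vdm (fun i : 'I_N => 'X_(lift ord0 i)))@_(mcons a (fun=> b)) =
  N`!%:R * (PsiX q k N.+1)@_(mcons a (fun i : 'I_N => b - i)%N).
Proof.
move=> leN; set m := mcons a (fun i : 'I_N => b - i)%N.
rewrite vdmE -det_tr /determinant mulr_sumr (raddf_sum (mcoeff _)) /=.
transitivity (\sum_(s : 'S_N) (PsiX q k N.+1)@_m); last first.
  by rewrite sumr_const mulr_natl -(card_Sn N) cardT -cardE.
apply: eq_bigr => s _.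
have -> : \prod_i (\matrix_(p < N, i < N) 'X_(lift ord0 i) ^+ p)^T i (s i) =
    \prod_i 'X_(lift ord0 i) ^+ (s i) :> {mpoly R[N.+1]}.
  by apply: eq_bigr => i _; rewrite !mxE.
have sE p (c : bool) e : (p * ((-1) ^+ c * e : {mpoly R[N.+1]})) = (-1) ^+ c * (p * e).
  by rewrite mulrCA.
have sC (c : bool) (p : {mpoly R[N.+1]}) l : ((-1) ^+ c * p)@_l = (-1) ^+ c * p@_l.
  by case: c; rewrite ?expr0 ?mul1r // expr1 !mulN1r mcoeffN.
rewrite sE sC.
(* The subtraction is exact because [s i < N <= b.+1]. *)
have -> : mcons a (fun=> b) = mcons a (fun i : 'I_N => s i + (b - s i))%N.
  apply/mnmP => i; rewrite !mnmE /vcons; case: unliftP => [j _|//].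
  by have := ltn_ord (s j); lia.
rewrite mcoeffMXs.
(* The remaining exponents are those of [m] permuted by [s] with x_1 fixed; the sign this produces
   cancels the sign in the determinant. *)
have -> : mcons a (fun i : 'I_N => b - s i)%N =
    [multinom m (lift_perm ord0 ord0 s i) | i < N.+1].
  apply/mnmP => i; rewrite !mnmE; case: (unliftP ord0 i) => [j ->|->].
    by rewrite lift_perm_lift !vconsS.
  by rewrite lift_perm_id !vcons0.
by rewrite mcoeff_PsiX_perm odd_lift_perm mulrA -signr_addb /= addbb mul1r.
Qed.

(** * Recursion and closed form at z = q^k *)

(* A_{1,m,N+1} at z = q^k, where u = k - m; the exponents are shifted by
   m + N (k - 1) because denominators have been cleared in PsiX. *)
Definition coefA (R : comNzRingType) (q : R) k N u : R :=
  (PsiX q k N.+1)@_(mcons (N * u) (fun i : 'I_N => N.+1 * k - u - i.+1)%N).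

Lemma prodr_expr (A : comNzRingType) (q : A) n (f : nat -> nat) :
  \prod_(i < n) q ^+ f i = q ^+ (\sum_(i < n) f i).
Proof. by rewrite expr_sum. Qed.

Lemma sum_odd N : (\sum_(p < N) (p + p.+1) = N * N)%N.
Proof. by elim: N => [|N IH]; rewrite ?big_ord0 // big_ord_recr IH /=; lia. Qed.

Lemma prod_rev (A : comNzRingType) n (F : nat -> A) :
  \prod_(p < n) F (n - p.+1)%N = \prod_(p < n) F p.
Proof. by rewrite [RHS](reindex_inj rev_ord_inj). Qed.

(** The weights w = - z^(N+1) and w = -1 give two equations with the same unknown coefficient [l],
    which is eliminated. *)
Lemma vdm_coef_rec (R : idomainType) (q : R) k N u (z := q ^+ k)
    (a := fun u => (PsiX q k N.+1 * vdm (fun i : 'I_N => 'X_(lift ord0 i)))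
                   @_(mcons (N * u) (fun=> N.+1 * k - u.+1)%N)) :
  q != 0 -> (forall j, (0 < j)%N -> 1 - q ^+ j != 0) ->
  (0 < k)%N -> (0 < u)%N -> (u < N.+1 * k)%N ->
  (\prod_(p < N) z ^+ p.+1) * (\prod_(p < N) (q ^+ (N.+1 * k - u) - z ^+ p)) * a u.-1 =
  (\prod_(p < N) (q ^+ (N.+1 * k - u) - z ^+ N.+1 * z ^+ p)) * a u.
Proof.
move=> q0 q1 k0 u0 lt; pose e := (N.+1 * k - u)%N.
pose x (i : 'I_N) : {mpoly R[N.+1]} := 'X_(lift ord0 i).
pose y : {mpoly R[N.+1]} := 'X_ord0.
pose s := mcons (N * u) (fun _ : 'I_N => e).
pose l := (PsiX q k N.+1 * (\prod_i (y - z%:MP * x i)) * vdm x)@_s.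
pose Z := (\prod_(i < N) \prod_(j < N | (i < j)%N) z) * z ^+ N.
pose Q := \prod_(p < N) (1 - z ^+ p.+2).
(* Removing [y ^+ N] lowers the exponent [N * u] of x_1 by N, that is, [u] by one. *)
have topE : Z * ((\prod_(p < N) z ^+ p.+1) * Q * a u.-1) =
    q ^+ (N * u) * (\prod_(p < N) (q ^+ e - z ^+ N.+1 * z ^+ p)) * l.
  have -> : \prod_(p < N) (q ^+ e - z ^+ N.+1 * z ^+ p) =
            \prod_(p < N) (q ^+ e + (- z ^+ N.+1) * z ^+ p).
    by apply: eq_bigr => p _; rewrite mulNr.
  rewrite -(@PsiX_shift_sum R q (- z ^+ N.+1) k N (N * u) e k0) -/Z; congr (_ * _).
  have -> : (- z ^+ N.+1)%:MP = - z%:MP ^+ N.+1 :> {mpoly R[N.+1]}.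
    by rewrite rmorphN; congr (- _); rewrite rmorphXn.
  rewrite sum_vdm_top -/x -/y.
  have -> : \prod_(p < N) (z%:MP ^+ p.+1 - z%:MP ^+ N.+2) =
     ((\prod_(p < N) z ^+ p.+1) * Q)%:MP :> {mpoly R[N.+1]}.
    rewrite /Q -(prod_rev _ (fun p => 1 - z ^+ p.+2)) -big_split /= rmorph_prod.
    apply: eq_bigr => p _; rewrite -!rmorphXn -rmorphB; congr (_%:MP).
    rewrite mulrBr mulr1 -exprD; congr (_ - _ ^+ _).
    by have := ltn_ord p; lia.
  have -> c : PsiX q k N.+1 * (c%:MP * y ^+ N * vdm x) =
      c%:MP * (PsiX q k N.+1 * vdm x * y ^+ N) by ring.
  rewrite mcoeffCM /s; congr (_ * _).
  have -> : (N * u = N + N * u.-1)%N by rewrite -[X in (X + _)%N]muln1 -mulnDr add1n prednK.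
  by rewrite mcoeffMX0 /a prednK.
(* Removing the product of the [x i] lowers the other exponents from [e] to [e - 1], which are those
   belonging to [u] itself. *)
have botE : Z * (Q * a u) = q ^+ (N * u) * (\prod_(p < N) (q ^+ e - z ^+ p)) * l.
  have -> : \prod_(p < N) (q ^+ e - z ^+ p) = \prod_(p < N) (q ^+ e + (- 1) * z ^+ p).
    by apply: eq_bigr => p _; rewrite mulN1r.
  rewrite -(@PsiX_shift_sum R q (- 1) k N (N * u) e k0) -/Z; congr (_ * _).
  rewrite rmorphN rmorph1 /= sum_vdm_bot -/x -/y.
  have -> : \prod_(p < N) (1 - z%:MP ^+ p.+2) = Q%:MP :> {mpoly R[N.+1]}.
    rewrite /Q rmorph_prod.
    by apply: eq_bigr => p _; rewrite rmorphB rmorph1 [in RHS]/= -[in LHS]rmorphXn.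
  have -> c : PsiX q k N.+1 * (c%:MP * \prod_i x i * vdm x) =
      c%:MP * (PsiX q k N.+1 * vdm x * \prod_i x i) by ring.
  rewrite mcoeffCM /s /a; congr (_ * _).
  have -> : \prod_i x i = \prod_i 'X_(lift ord0 i) ^+ 1.
    by apply: eq_bigr => i _; rewrite expr1.
  have -> : e = (1 + (N.+1 * k - u.+1))%N by rewrite /e; lia.
  by rewrite (mcoeffMXs _ _ (fun=> 1%N)).
have z0 : z != 0 by rewrite expf_neq0.
have Q0 : Z * Q != 0.
  rewrite /Z /Q !mulf_neq0 ?expf_neq0 //.
    by apply/prodf_neq0 => i _; apply/prodf_neq0.
  by apply/prodf_neq0 => i _; rewrite /z -exprM q1 // muln_gt0 k0.
apply: (mulfI Q0); rewrite -/e.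
set F := \prod_(p < N) (q ^+ e - z ^+ p) in botE *.
set G := \prod_(p < N) (q ^+ e - z ^+ N.+1 * z ^+ p) in topE *.
transitivity (F * (Z * ((\prod_(p < N) z ^+ p.+1) * Q * a u.-1))); first by ring.
by rewrite topE; transitivity (G * (Z * (Q * a u))); [rewrite botE; ring | ring].
Qed.

(** The recursion between A_m and A_(m+1), with u = k - m. The bound [u < 2 * k] makes all exponents
    [p.+2 * k - u] positive, and [N]! is the multiplicity of the Vandermonde expansion, to be
    cancelled. *)
Lemma coefA_rec (R : idomainType) (q : R) k N u :
  q != 0 -> (forall j, (0 < j)%N -> 1 - q ^+ j != 0) -> N`!%:R != 0 :> R ->
  (0 < k)%N -> (0 < N)%N -> (0 < u < 2 * k)%N ->
  q ^+ (N * k) * (\prod_(p < N) (1 - q ^+ (u + p * k))) * coefA q k N u =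
  (-1) ^+ N * q ^+ (N * u) * (\prod_(p < N) (1 - q ^+ (p.+2 * k - u))) * coefA q k N u.-1.
Proof.
move=> q0 q1 ch k0 N0 /andP[u0 u2].
have lt : (u < N.+1 * k)%N by nia.
have := vdm_coef_rec q0 q1 k0 u0 lt.
rewrite !mcoeff_PsiX_vdm; [|nia|nia].
have AE v : (PsiX q k N.+1)@_(mcons (N * v) (fun i : 'I_N => N.+1 * k - v.+1 - i)%N) = coefA q k N v.
  congr (mcoeff _ _); apply/mnmP => i; rewrite !mnmE /vcons.
  by case: unliftP => [j _|//]; lia.
rewrite !AE => rec.
have {rec} : (\prod_(p < N) (q ^+ k) ^+ p.+1) *
   (\prod_(p < N) (q ^+ (N.+1 * k - u) - (q ^+ k) ^+ p)) * coefA q k N u.-1 =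
   (\prod_(p < N) (q ^+ (N.+1 * k - u) - (q ^+ k) ^+ N.+1 * (q ^+ k) ^+ p)) * coefA q k N u.
  by apply: (mulfI ch); rewrite mulrCA rec mulrCA.
have -> : \prod_(p < N) (q ^+ (N.+1 * k - u) - (q ^+ k) ^+ N.+1 * (q ^+ k) ^+ p) =
   q ^+ (N * (N.+1 * k - u)) * \prod_(p < N) (1 - q ^+ (u + p * k)).
  have -> : q ^+ (N * (N.+1 * k - u)) = \prod_(p < N) q ^+ (N.+1 * k - u).
    by rewrite prodr_const card_ord -exprM mulnC.
  rewrite -big_split /=.
  apply: eq_bigr => p _; rewrite mulrBr mulr1 -!exprM -!exprD.
  by congr (_ - _ ^+ _); nia.
have -> : \prod_(p < N) (q ^+ (N.+1 * k - u) - (q ^+ k) ^+ p) =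
   (-1) ^+ N * (\prod_(p < N) (q ^+ k) ^+ p) * \prod_(p < N) (1 - q ^+ (p.+2 * k - u)).
  rewrite -(prod_rev N (fun p => 1 - q ^+ (p.+2 * k - u))).
  have -> : (-1) ^+ N = \prod_(p < N) (-1) :> R by rewrite prodr_const card_ord.
  rewrite -!big_split /=.
  apply: eq_bigr => p _.
  have -> : q ^+ (N.+1 * k - u) = (q ^+ k) ^+ p * q ^+ ((N - p.+1).+2 * k - u).
    by rewrite -exprM -exprD; congr (_ ^+ _); have := ltn_ord p; nia.
  by ring.
have zz : (\prod_(p < N) (q ^+ k) ^+ p.+1) * (\prod_(p < N) (q ^+ k) ^+ p) = q ^+ (k * (N * N)).
  rewrite (prodr_expr (q ^+ k) N S) (prodr_expr (q ^+ k) N id) -exprD -exprM -big_split /=.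
  rewrite -sum_odd; congr (q ^+ (_ * _)).
  by apply: eq_bigr => p _; rewrite addnC.
move=> rec; apply: (@mulfI _ (q ^+ (k * (N * N)))); first by rewrite expf_neq0.
rewrite -{2}zz.
set B := \prod_(p < N) (1 - q ^+ (p.+2 * k - u)) in rec *.
set C := \prod_(p < N) (1 - q ^+ (u + p * k)) in rec *.
transitivity (q ^+ (N * u) * (q ^+ (N * (N.+1 * k - u)) * C * coefA q k N u)).
  have -> : (k * (N * N) = N * u + N * (N.+1 * k - u) - N * k)%N by nia.
  rewrite !mulrA -!exprD; congr (q ^+ _ * _ * _); nia.
by rewrite -rec; ring.
Qed.

(** * The extremal coefficient, at x_1 = 0 *)

Definition mdrop0 (R : comNzRingType) n : {mpoly R[n.+1]} -> {mpoly R[n]} :=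
  mmap (@mpolyC n R) (vcons 0 (fun i => 'X_i)).

HB.instance Definition _ (R : comNzRingType) n :=
  GRing.RMorphism.copy (@mdrop0 R n) (mmap (@mpolyC n R) (vcons 0 (fun i => 'X_i))).

Lemma mcoeff_mdrop0 (R : comNzRingType) n (p : {mpoly R[n.+1]}) (m : 'X_{1..n}) :
  (mdrop0 p)@_m = p@_(mcons 0 m).
Proof.
rewrite [p]mpolyE (raddf_sum (@mdrop0 R n)) !(raddf_sum (mcoeff _)).
apply: eq_bigr => m' _ /=.
rewrite /mdrop0 mmapZ mmapX mcoeffCM mcoeffZ mcoeffX; congr (_ * _).
rewrite /mmap1 big_ord_recl vcons0.
have -> : \prod_(i < n) vcons 0 (fun i => 'X_i) (lift ord0 i) ^+ m' (lift ord0 i) =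
    'X_[[multinom m' (lift ord0 i) | i < n]] :> {mpoly R[n]}.
  by rewrite mpolyXE_id; apply: eq_bigr => i _; rewrite vconsS mnmE.
case: (posnP (m' ord0)) => [m0|m0]; last first.
  rewrite expr0n gtn_eqF // mul0r mcoeff0; case: eqP => // e.
  by move: m0; rewrite e mnmE vcons0.
rewrite m0 expr0 mul1r mcoeffX; congr (_%:R); congr nat_of_bool.
apply/eqP/eqP => [<-|->]; apply/mnmP => i; rewrite !mnmE; last by rewrite vconsS.
by case: (unliftP ord0 i) => [j ->|->]; rewrite ?vconsS ?vcons0 ?mnmE.
Qed.

Lemma pairf0 (A : comPzRingType) (q : A) k (y : A) : (0 < k)%N ->
  pairf q k 0 y = (-1) ^+ k * q ^+ 'C(k, 2) * y ^+ (k + k.-1).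
Proof.
case: k => // k _; rewrite /pairf sub0r.
have -> : \prod_(l < k) ((y - q ^+ l.+1 * 0) * (0 - q ^+ l.+1 * y)) =
    (-1) ^+ k * q ^+ 'C(k.+1, 2) * (y ^+ (k + k)).
  elim: k => [|k IH]; first by rewrite big_ord0 bin_small // !mulr1.
  have -> : 'C(k.+2, 2) = ('C(k.+1, 2) + k.+1)%N by rewrite binS bin1.
  have -> : (k.+1 + k.+1 = (k + k).+2)%N by lia.
  rewrite big_ord_recr IH /= [q ^+ (_ + _)]exprD.
  by rewrite [(-1) ^+ k.+1]exprS [y ^+ _.+2]exprS [y ^+ _.+1]exprS; ring.
by rewrite /= addSn [(-1) ^+ k.+1]exprS [y ^+ _.+1]exprS; ring.
Qed.

Lemma coefA0 (R : comNzRingType) (q : R) k : coefA q k 0 k = 1.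
Proof.
rewrite /coefA /PsiX /Psi big_ord1 big_pred0; last by move=> j; rewrite !ord1.
rewrite mcoeff1; case: eqP => // -[]; apply/mnmP => i; rewrite mnm0E mnmE /vcons.
by case: unliftP => [[]|].
Qed.

(** At u = 0 the exponent of x_1 is 0, so x_1 = 0 may be substituted. Each pair with x_1 then leaves
    a constant times x_j^(2k-1); removing these powers gives the exponents of u = k, i.e. m = 0, in
    one variable fewer. *)
Lemma coefA_base (R : comNzRingType) (q : R) k N : (0 < k)%N ->
  coefA q k N.+1 0 = (-1) ^+ (k * N.+1) * q ^+ ('C(k, 2) * N.+1) * coefA q k N k.
Proof.
move=> k0; pose m := [multinom (N * k - i)%N | i < N.+1].
pose d := [multinom (k + k.-1)%N | i < N.+1].
have -> : coefA q k N.+1 0 = (PsiX q k N.+2)@_(mcons 0 (d + m)%MM).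
  congr (mcoeff _ _); apply/mnmP => i; rewrite !mnmE /vcons.
  case: unliftP => [[j ltj] _|_]; rewrite ?muln0 // !mnmE /=.
  have jN : (j <= N * k)%N by apply: leq_trans (leq_pmulr N k0); rewrite -ltnS.
  by rewrite !mulSn; lia.
rewrite -mcoeff_mdrop0 /PsiX (rmorph_Psi (@mdrop0 R N.+1)) /=.
have -> : Psi (mdrop0 q%:MP) k (fun i => mdrop0 'X_i) =
    Psi q%:MP k (vcons 0 (fun i => 'X_i)) :> {mpoly R[N.+1]}.
  rewrite {1}/mdrop0 mmapC; apply: eq_Psi => i.
  by rewrite /mdrop0 mmapX mmap1U.
rewrite Psi_cons.
have -> : \prod_(j < N.+1) pairf q%:MP k 0 'X_j =
    ((-1) ^+ (k * N.+1) * q ^+ ('C(k, 2) * N.+1))%:MP * 'X_[d] :> {mpoly R[N.+1]}.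
  under eq_bigr do rewrite pairf0 //.
  rewrite big_split /= prodr_const card_ord mpolyXE_id rmorphM !exprM exprMn.
  congr (_ * _ * _); rewrite ?rmorphXn ?rmorphN ?rmorph1 //.
  by apply: eq_bigr => i _; rewrite mnmE.
rewrite -[_ * 'X_[d] * _]mulrA mcoeffCM; congr (_ * _); rewrite mulrC mcoeffMX.
congr (mcoeff _ _); apply/mnmP => i; rewrite !mnmE /vcons.
case: unliftP => [j ->|->] /=; rewrite ?lift0 ?mulSn ?addKn ?subn0 //.
Qed.

(** Finite stand-in for (q^a; q)_oo. The ratio of two of them does not depend on [B] once [B] is
    above both starting points. *)
Definition qpi (R : comNzRingType) (q : R) B a : R := \prod_(a <= l < B) (1 - q ^+ l).

Lemma qpi_rec (R : comNzRingType) (q : R) B a : (a < B)%N ->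
  qpi q B a = (1 - q ^+ a) * qpi q B a.+1.
Proof. by move=> lt; rewrite /qpi big_ltn. Qed.

Lemma qpi_neq0 (R : idomainType) (q : R) B a :
  (forall j, (0 < j)%N -> 1 - q ^+ j != 0) -> (0 < a)%N -> qpi q B a != 0.
Proof.
move=> q1 a0; rewrite /qpi prodf_seq_neq0; apply/allP => l.
by rewrite mem_index_iota => /andP[al _]; apply/q1/(leq_trans a0).
Qed.

Lemma prod_shift (A : comNzRingType) N (F : nat -> A) :
  (\prod_(i < N) F i.+1) * F 0 = (\prod_(i < N) F i) * F N.
Proof. by rewrite mulrC -(big_ord_recl N (fun i : 'I_N.+1 => F i)) big_ord_recr. Qed.

(** [coefA_den] and [coefA_num] are the denominator and numerator of the claimed product at z = q^k,
    n = N + 1, m = k - u, with [qpi] for the infinite products and i counted from 0. *)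
Definition coefA_den (R : comNzRingType) (q : R) k N B : R :=
  qpi q B 1 ^+ N.-1 * qpi q B (1 + k * N) * (\prod_(i < N) (1 - q ^+ (k * i.+1))) *
  \prod_(i < N) (qpi q B (k * i.+2) * qpi q B (k * i + 1)).

Definition coefA_num (R : comNzRingType) (q : R) k N B u : R :=
  qpi q B k ^+ N * \prod_(i < N) (qpi q B (k * i + 1 + u) * qpi q B (k * i.+2 - u)).

(** Induction on [u], that is, downwards from m = k; the last hypothesis is the value at m = 0 in
    one variable fewer. The power of q is the claimed one because C(k,2) + C(u+1,2) - k u = m (m-1)
    / 2. *)
Lemma coefA_closed_aux (R : idomainType) (q : R) k N B u :
  q != 0 -> (forall j, (0 < j)%N -> 1 - q ^+ j != 0) -> N.+1`!%:R != 0 :> R ->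
  (0 < k)%N -> (N.+4 * k < B)%N -> (u < 2 * k)%N ->
  coefA q k N k * qpi q B 1 ^+ N * (\prod_(i < N) (1 - q ^+ (k * i.+1))) *
    qpi q B (k * N.+1) = qpi q B k ^+ N.+1 ->
  q ^+ (N.+1 * k * u) * coefA q k N.+1 u * coefA_den q k N.+1 B =
  (-1) ^+ (N.+1 * (k + u)) * q ^+ (N.+1 * ('C(k, 2) + 'C(u.+1, 2))) * coefA_num q k N.+1 B u.
Proof.
move=> q0 q1 ch k0 kB u2 mac; elim: u u2 => [|u IH] u2.
  rewrite muln0 expr0 mul1r coefA_base // addn0 (@bin_small 1 2) // addn0.
  rewrite ![(N.+1 * _)%N]mulnC -!mulrA; congr (_ * (_ * _)).
  rewrite /coefA_den /coefA_num -mac /=.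
  have -> : \prod_(i < N.+1) (qpi q B (k * i + 1 + 0) * qpi q B (k * i.+2 - 0)) =
      \prod_(i < N.+1) (qpi q B (k * i.+2) * qpi q B (k * i + 1)).
    by apply: eq_bigr => i _; rewrite addn0 subn0 mulrC.
  rewrite (@qpi_rec _ _ _ (k * N.+1)); last by nia.
  by rewrite add1n [in LHS]big_ord_recr /=; ring.
have C0 : \prod_(p < N.+1) (1 - q ^+ (u.+1 + p * k)) != 0.
  by apply/prodf_neq0 => p _; apply: q1.
apply: (mulfI C0).
have /= rec := @coefA_rec R q k N.+1 u.+1 q0 q1 ch k0 isT u2.
have {}IH := IH (ltnW u2).
set C := \prod_(p < N.+1) (1 - q ^+ (u.+1 + p * k)) in rec *.
set D := \prod_(p < N.+1) (1 - q ^+ (p.+2 * k - u.+1)) in rec.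
(* Increasing [u] moves one end of each [qpi] by one factor; these factors are the two sides of the
   recursion. *)
have numE : C * coefA_num q k N.+1 B u.+1 = D * coefA_num q k N.+1 B u.
  rewrite /coefA_num mulrCA [RHS]mulrCA; congr (_ * _).
  rewrite /C /D -!big_split /=; apply: eq_bigr => i _.
  rewrite (@qpi_rec _ _ _ (k * i + 1 + u)); last by have := ltn_ord i; nia.
  rewrite (@qpi_rec _ _ _ (k * i.+2 - u.+1)); last by have := ltn_ord i; nia.
  have -> : (k * i.+2 - u.+1).+1 = (k * i.+2 - u)%N by nia.
  have -> : (k * i + 1 + u).+1 = (k * i + 1 + u.+1)%N by lia.
  have -> : (k * i + 1 + u)%N = (u.+1 + i * k)%N by nia.
  have -> : (i.+2 * k - u.+1)%N = (k * i.+2 - u.+1)%N by nia.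
  by ring.
transitivity (q ^+ (N.+1 * k * u) * (q ^+ (N.+1 * k) * C * coefA q k N.+1 u.+1) * coefA_den q k N.+1 B).
  by rewrite mulnS exprD; ring.
rewrite rec; transitivity ((-1) ^+ N.+1 * q ^+ (N.+1 * u.+1) * D *
   (q ^+ (N.+1 * k * u) * coefA q k N.+1 u * coefA_den q k N.+1 B)); first by ring.
rewrite IH; transitivity ((-1) ^+ (N.+1 * (k + u.+1)) *
   q ^+ (N.+1 * ('C(k, 2) + 'C(u.+2, 2))) * (D * coefA_num q k N.+1 B u)).
  have -> : (N.+1 * (k + u.+1) = N.+1 + N.+1 * (k + u))%N by nia.
  have -> : (N.+1 * ('C(k, 2) + 'C(u.+2, 2)) = N.+1 * u.+1 + N.+1 * ('C(k, 2) + 'C(u.+1, 2)))%N.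
    by rewrite [in LHS]binS bin1; nia.
  by rewrite !exprD; ring.
by rewrite -numE; ring.
Qed.

Lemma bin2_add k : ('C(k, 2) + 'C(k.+1, 2) = k * k)%N.
Proof.
elim: k => // k; have -> : 'C(k.+2, 2) = ('C(k.+1, 2) + k.+1)%N by rewrite binS bin1.
by have -> : 'C(k.+1, 2) = ('C(k, 2) + k)%N; [rewrite binS bin1 | nia].
Qed.

(** The case m = 0: with n = N + 1 the value is (q;q)_(nk-1) / ((q;q)_(k-1)^n prod_(0 < i < n) (1 -
    q^(ki))). In the induction, the value for N gives the closed form for N + 1, whose instance u =
    k is again the case m = 0. *)
Lemma coefA_symm (R : idomainType) (q : R) k N B :
  q != 0 -> (forall j, (0 < j)%N -> 1 - q ^+ j != 0) -> N`!%:R != 0 :> R ->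
  (0 < k)%N -> (N.+4 * k < B)%N ->
  coefA q k N k * qpi q B 1 ^+ N * (\prod_(i < N) (1 - q ^+ (k * i.+1))) *
    qpi q B (k * N.+1) = qpi q B k ^+ N.+1.
Proof.
move=> q0 q1; elim: N => [|N IH] ch k0 kB.
  by rewrite coefA0 expr0 big_ord0 !mul1r muln1.
have ch' : N`!%:R != 0 :> R.
  by move: ch; rewrite factS natrM mulf_eq0 negb_or => /andP[].
have {}IH : _ := IH ch' k0 (leq_ltn_trans _ kB).
have /IH{}IH : (N.+4 * k <= N.+1.+4 * k)%N by rewrite leq_mul2r leqnSn orbT.
have k2 : (k < 2 * k)%N by lia.
have kB' : (N.+4 * k < B)%N by nia.
have := @coefA_closed_aux R q k N B k q0 q1 ch k0 kB' k2 IH.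
have -> : (-1) ^+ (N.+1 * (k + k)) = 1 :> R.
  by rewrite addnn -mul2n mulnCA exprM sqrrN expr1n expr1n.
rewrite bin2_add mul1r mulnA -mulrA => /(mulfI (expf_neq0 _ q0)) E.
(* At u = k the numerator consists of the denominator's products with the index moved by one, so
   they telescope. *)
have e1 := prod_shift N.+1 (fun i => qpi q B (k * i.+1)).
have e2 := prod_shift N.+1 (fun i => qpi q B (k * i + 1)).
rewrite /= muln1 muln0 add0n in e1 e2.
have p1 a : (0 < a)%N -> qpi q B a != 0 by apply: qpi_neq0.
move: E; rewrite /coefA_den /coefA_num /= !big_split /= [(1 + _)%N]addnC.
have -> : \prod_(i < N.+1) qpi q B (k * i + 1 + k) = \prod_(i < N.+1) qpi q B (k * i.+1 + 1).
  by apply: eq_bigr => i _; rewrite mulnS; congr (qpi q B _); lia.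
have -> : \prod_(i < N.+1) qpi q B (k * i.+2 - k) = \prod_(i < N.+1) qpi q B (k * i.+1).
  by apply: eq_bigr => i _; rewrite [in LHS]mulnS addKn.
set P1 := \prod_(i < N.+1) qpi q B (k * i.+1) in e1 *.
set P2 := \prod_(i < N.+1) qpi q B (k * i + 1) in e2 *.
set P3 := \prod_(i < N.+1) qpi q B (k * i.+2) in e1 *.
set P4 := \prod_(i < N.+1) qpi q B (k * i.+1 + 1) in e2 *.
set D := \prod_(i < N.+1) (1 - q ^+ _) => E.
have X0 : P2 * qpi q B (k * N.+1 + 1) * P1 != 0.
  rewrite !mulf_neq0 ?p1 ?addn1 //; apply/prodf_neq0 => i _; rewrite p1 ?addn1 //.
  by rewrite muln_gt0 k0.
apply: (mulIf X0).
transitivity (qpi q B 1 * (coefA q k N.+1 k * (qpi q B 1 ^+ N * qpi q B (k * N.+1 + 1) * D *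
   ((P1 * qpi q B (k * N.+2)) * P2)))); first by rewrite [qpi q B 1 ^+ N.+1]exprS; ring.
rewrite -e1; transitivity (qpi q B 1 * qpi q B k *
   (coefA q k N.+1 k * (qpi q B 1 ^+ N * qpi q B (k * N.+1 + 1) * D * (P3 * P2)))); first by ring.
rewrite E; transitivity (qpi q B k * qpi q B k ^+ N.+1 * (P4 * qpi q B 1) * P1); first by ring.
by rewrite e2 [qpi q B k ^+ N.+2]exprS; ring.
Qed.

Lemma coefA_closed (R : idomainType) (q : R) k N B u :
  q != 0 -> (forall j, (0 < j)%N -> 1 - q ^+ j != 0) -> N.+1`!%:R != 0 :> R ->
  (0 < k)%N -> (N.+4 * k < B)%N -> (u < 2 * k)%N ->
  q ^+ (N.+1 * k * u) * coefA q k N.+1 u * coefA_den q k N.+1 B =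
  (-1) ^+ (N.+1 * (k + u)) * q ^+ (N.+1 * ('C(k, 2) + 'C(u.+1, 2))) * coefA_num q k N.+1 B u.
Proof.
move=> q0 q1 ch k0 kB u2; apply: coefA_closed_aux => //; apply: coefA_symm => //.
by move: ch; rewrite factS natrM mulf_eq0 negb_or => /andP[].
Qed.

(** * Formal series at z = q^k *)

Section Evaluation.

Context (n : nat) (K : fieldType) (io : {rmorphism {mpoly {poly int}[n]} -> K}).
Context (io_inj : injective io).
Context (k : nat).

Definition qK : K := io ('X%:MP).
Definition xK i : K := io 'X_i.
Definition weight (e : expo n) : int := e.1.2 + e.1.1 * k%:Z.
(** Negative exponents require a field; injectivity of [io] brings identities back to
    polynomials. *)
Definition evm (e : expo n) : K := qK ^ weight e * \prod_i xK i ^ e.2 i.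
Definition ev (p : lpoly n) : K := \sum_(t <- p) t.1%:~R * evm t.2.

Lemma io_neq0 p : p != 0 -> io p != 0.
Proof. by move=> p0; rewrite -(rmorph0 io) (inj_eq io_inj). Qed.

Lemma qK_neq0 : qK != 0.
Proof. by apply: io_neq0; rewrite mpolyC_eq0 polyX_eq0. Qed.

Lemma xK_neq0 i : xK i != 0.
Proof.
apply: io_neq0; apply/eqP => /(congr1 (mcoeff U_(i))).
by rewrite mcoeffXU eqxx mcoeff0 => /eqP; rewrite oner_eq0.
Qed.

Lemma weightD e f : weight (eadd e f) = weight e + weight f.
Proof. by rewrite /weight /=; ring. Qed.

Lemma evmD e f : evm (eadd e f) = evm e * evm f.
Proof.
rewrite /evm weightD expfzDr ?qK_neq0 // mulrACA; congr (_ * _).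
rewrite -big_split; apply: eq_bigr => i _ /=.
by rewrite ffunE expfzDr ?xK_neq0.
Qed.

Lemma evm0 : evm (ezero n) = 1.
Proof.
rewrite /evm /weight /= mul0r addr0 expr0z mul1r big1 // => i _.
by rewrite ffunE expr0z.
Qed.

Lemma escale0 (e : expo n) : escale 0 e = ezero n.
Proof. by rewrite /escale /ezero; congr (_, _, _); apply/ffunP => i; rewrite !ffunE. Qed.

Lemma escaleS j (e : expo n) : escale j.+1 e = eadd e (escale j e).
Proof.
rewrite /escale /eadd /= !mulrS; congr (_, _, _).
by apply/ffunP => i; rewrite !ffunE mulrS.
Qed.

Lemma evmX e j : evm (escale j e) = evm e ^+ j.
Proof.
elim: j => [|j IH]; first by rewrite escale0 evm0 expr0.
by rewrite escaleS evmD IH exprS.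
Qed.

Lemma evm_xexp (f : {ffun 'I_n -> int}) : evm (xexp f) = \prod_i xK i ^ f i.
Proof. by rewrite /evm /weight /= mul0r addr0 expr0z mul1r. Qed.

Lemma evm_zq a b : evm (zq n a b) = qK ^ (b + a * k%:Z).
Proof. by rewrite /evm big1 ?mulr1 // => i _; rewrite ffunE expr0z. Qed.

Lemma ev_mon c e : ev (lmon c e) = c%:~R * evm e.
Proof. by rewrite /ev big_seq1. Qed.

Lemma ev_one : ev (lone n) = 1.
Proof. by rewrite ev_mon evm0 mulr1. Qed.

Lemma ev_add p r : ev (ladd p r) = ev p + ev r.
Proof. by rewrite /ev big_cat. Qed.

Lemma ev_mul p r : ev (lmul p r) = ev p * ev r.
Proof.
rewrite /ev /lmul big_allpairs_dep /= mulr_suml; apply: eq_bigr => s _.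
rewrite mulr_sumr; apply: eq_bigr => t _ /=.
by rewrite evmD intrM; ring.
Qed.

Lemma ev_prod (ps : seq (lpoly n)) : ev (lprod ps) = \prod_(p <- ps) ev p.
Proof.
elim: ps => [|p ps IH]; first by rewrite big_nil ev_one.
by rewrite big_cons -IH -ev_mul.
Qed.

Lemma ev_prod_map (I : Type) (s : seq I) (F : I -> lpoly n) :
  ev (lprod [seq F i | i <- s]) = \prod_(i <- s) ev (F i).
Proof. by rewrite ev_prod big_map. Qed.

Lemma ev_poch u b T :
  ev (poch u b T) = \prod_(l < T) (1 - evm u * evm b ^+ l).
Proof.
rewrite /poch ev_prod_map -[X in iota 0 X](subn0 T) -/(index_iota 0 T) big_mkord.
by apply: eq_bigr => l _; rewrite ev_add ev_one ev_mon evmD evmX mulN1r.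
Qed.

Lemma ev_geom w T : ev (geom w T) = \sum_(j < T) evm w ^+ j.
Proof.
rewrite /ev /geom /lsum big_flatten /= big_map.
rewrite -[X in iota 0 X](subn0 T) -/(index_iota 0 T) big_mkord.
by apply: eq_bigr => j _; rewrite big_seq1 mul1r evmX.
Qed.

Lemma ev_ipoch u b C T :
  ev (ipoch u b C T) = \prod_(l < C) \sum_(j < T) (evm u * evm b ^+ l) ^+ j.
Proof.
rewrite /ipoch ev_prod_map -[X in iota 0 X](subn0 C) -/(index_iota 0 C) big_mkord.
by apply: eq_bigr => l _; rewrite ev_geom evmD evmX.
Qed.

(* The coefficient of q^c after the substitution z = q^k. *)
Definition wcoef (p : lpoly n) (c : int) (lam : {ffun 'I_n -> int}) : int :=
  \sum_(t <- p | (weight t.2 == c) && (t.2.2 == lam)) t.1.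

Definition XX : {mpoly {poly int}[n]} := \prod_i 'X_i.

Lemma XXE s : XX ^+ s = 'X_[[multinom s | i < n]].
Proof. by rewrite /XX -prodrXl mpolyXE_id; apply: eq_bigr => i _; rewrite mnmE. Qed.

Lemma wcoefE (p : lpoly n) s P (mu : 'X_{1..n}) (lam : {ffun 'I_n -> int}) (c : nat) :
  (forall t, t \in p -> 0 <= weight t.2) ->
  ev p * io XX ^+ s = io P -> (forall i, lam i + s%:Z = (mu i)%:Z) ->
  wcoef p c lam = P@_mu`_c.
Proof.
move=> wp evp lamE.
(* The shift [s] makes the value of [p] a polynomial, but single terms that cancel in the sum may
   still have negative exponents; the further shift [S] makes every term polynomial. *)
have [S HS] : exists S : nat, forall t, t \in p -> forall i, 0 <= t.2.2 i + S%:Z.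
  clear; elim: p => [|t p [S IH]]; first by exists 0%N.
  pose M := (\sum_i `|t.2.2 i|)%N.
  have leM i : (`|t.2.2 i| <= M)%N by rewrite /M (bigD1 i) //= leq_addr.
  have H0 (e : int) : (`|e| <= M)%N -> 0 <= e + (S + M)%N%:Z by lia.
  have H1 (e : int) : 0 <= e + S%:Z -> 0 <= e + (S + M)%N%:Z by lia.
  exists (S + M)%N => t'; rewrite inE => /orP[/eqP ->|/IH H] i.
    by apply: H0 (leM i).
  by apply: H1 (H i).
pose mon (e : expo n) : 'X_{1..n} := [multinom `|(e.2 i + (s + S)%N%:Z)%R|%N | i < n].
pose Q := \sum_(t <- p) ((t.1%:P * 'X^`|weight t.2|%N)%:MP * 'X_[mon t.2]).
have PQ : P * XX ^+ S = Q.
  apply: io_inj; rewrite rmorphM -evp rmorphXn -mulrA -exprD /ev mulr_suml rmorph_sum.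
  rewrite !big_seq; apply: eq_bigr => t tp.
  rewrite rmorphM mpolyCM rmorphM; rewrite -mulrA -mulrA; congr (_ * _).
    have -> : t.1%:P = t.1%:~R :> {poly int} by rewrite -{1}[t.1]intz -[RHS](rmorph_int (@polyC int)).
    by rewrite !rmorph_int.
  rewrite /evm -mulrA; congr (_ * _).
    rewrite rmorphXn rmorphXn -/qK exprnP; congr (_ ^ _).
    by rewrite gez0_abs // wp.
  rewrite mpolyXE_id rmorph_prod /XX rmorph_prod -prodrXl -big_split /=.
  apply: eq_bigr => i _; rewrite rmorphXn mnmE -/(xK i) !exprnP -expfzDr ?xK_neq0 //.
  have ge0 (e : int) : 0 <= e + S%:Z -> e + (s + S)%N%:Z = `|(e + (s + S)%N%:Z)%R|%N%:Z by lia.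
  by congr (_ ^ _); apply: ge0 (HS _ tp i).
have -> : P@_mu = Q@_([multinom S | i < n] + mu)%MM by rewrite -PQ XXE mcoeffMX.
rewrite /Q (raddf_sum (mcoeff _)) coef_sum /wcoef big_mkcond !big_seq.
apply: eq_bigr => t tp /=; rewrite mcoeffCM mcoeffX.
have -> : (mon t.2 == ([multinom S | i < n] + mu)%MM) = (t.2.2 == lam).
  apply/eqP/eqP => [/mnmP e|e]; [apply/ffunP => i|apply/mnmP => i].
    have := e i; rewrite mnmDE !mnmE => {}e.
    have inj (a b : int) (d : nat) : 0 <= a + S%:Z -> b + s%:Z = d%:Z ->
      `|(a + (s + S)%N%:Z)%R|%N = (S + d)%N -> a = b by lia.
    exact: inj (HS _ tp i) (lamE i) e.
  have inj (a : int) (d : nat) : a + s%:Z = d%:Z ->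
      `|(a + (s + S)%N%:Z)%R|%N = (S + d)%N by lia.
  by rewrite mnmDE !mnmE e; apply: inj (lamE i).
case: (t.2.2 == lam); rewrite ?andbF ?andbT ?mulr0 ?coef0 //.
rewrite mulr1 coefCM coefXn.
have -> : (c == `|weight t.2|%N) = (weight t.2 == c).
  by have := wp _ tp; generalize (weight t.2); lia.
by case: eqP => _; rewrite ?mulr1 ?mulr0.
Qed.

End Evaluation.

(** * Congruences modulo powers of q *)

Section Congruence.

Context (n : nat) (K : fieldType) (io : {rmorphism {mpoly {poly int}[n]} -> K}).
Context (io_inj : injective io).

Local Notation q := (qK io).
Local Notation x := (xK io).

(* The ideal generated by q^M in the ring of polynomials in q with
   coefficients in the Laurent polynomials in x_1, .., x_n. *)
Definition inO (M : nat) (f : K) : Prop :=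
  exists s P, f * io (XX n) ^+ s = io (('X ^+ M)%:MP * P).

Definition cong (M : nat) (f g : K) : Prop := inO M (f - g).

Lemma inO_mul M M' f g : inO M f -> inO M' g -> inO (M + M') (f * g).
Proof.
move=> [s [P fE]] [s' [P' gE]]; exists (s + s')%N, (P * P').
by rewrite exprD mulrACA fE gE -rmorphM exprD mpolyCM; congr (io _); ring.
Qed.

Lemma inO_add M f g : inO M f -> inO M g -> inO M (f + g).
Proof.
move=> [s [P fE]] [s' [P' gE]]; exists (s + s')%N, (P * XX n ^+ s' + P' * XX n ^+ s).
transitivity (f * io (XX n) ^+ s * io (XX n) ^+ s' + g * io (XX n) ^+ s' * io (XX n) ^+ s).
  by rewrite exprD; ring.
by rewrite fE gE -!rmorphXn -!rmorphM -rmorphD; congr (io _); ring.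
Qed.

Lemma inO_opp M f : inO M f -> inO M (- f).
Proof. by move=> [s [P fE]]; exists s, (- P); rewrite mulNr fE mulrN rmorphN. Qed.

Lemma inO_weak M M' f : (M' <= M)%N -> inO M f -> inO M' f.
Proof.
move=> le [s [P fE]]; exists s, (('X ^+ (M - M'))%:MP * P).
by rewrite fE mulrA -mpolyCM -exprD subnKC.
Qed.

Lemma inO_io P : inO 0 (io P).
Proof. by exists 0%N, P; rewrite expr0 mulr1 mpolyC1 mul1r. Qed.

Lemma inO_0 M : inO M 0.
Proof. by exists 0%N, 0; rewrite mul0r mulr0 rmorph0. Qed.

Lemma inO_1 : inO 0 1.
Proof. by rewrite -(rmorph1 io); apply: inO_io. Qed.

Lemma inO_q j : inO j (q ^+ j).
Proof. by exists 0%N, 1; rewrite expr0 !mulr1 /qK -!rmorphXn. Qed.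

Lemma inO_x i : inO 0 (x i).
Proof. exact: inO_io. Qed.

Lemma inO_xV i : inO 0 (x i)^-1.
Proof.
exists 1%N, (\prod_(j < n | j != i) 'X_j); rewrite mpolyC1 mul1r expr1 /XX (bigD1 i) //=.
by rewrite rmorphM mulKf //; apply: xK_neq0.
Qed.

Lemma inO_mul0 f g : inO 0 f -> inO 0 g -> inO 0 (f * g).
Proof. exact: inO_mul. Qed.

Lemma inO_prod I (s : seq I) (P : pred I) (F : I -> K) :
  (forall i, P i -> inO 0 (F i)) -> inO 0 (\prod_(i <- s | P i) F i).
Proof. exact: (big_ind (inO 0) inO_1 inO_mul0). Qed.

Lemma inO_sum M I (s : seq I) (P : pred I) (F : I -> K) :
  (forall i, P i -> inO M (F i)) -> inO M (\sum_(i <- s | P i) F i).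
Proof. exact: (big_ind (inO M) (inO_0 M) (@inO_add M)). Qed.

Lemma inO_exp f j : inO 0 f -> inO 0 (f ^+ j).
Proof.
move=> Of; elim: j => [|j IH]; first exact: inO_1.
by rewrite exprS; apply: inO_mul0.
Qed.

Lemma inO_expM M f j : inO M f -> inO (M * j) (f ^+ j).
Proof.
move=> Of; elim: j => [|j IH]; first by rewrite muln0 expr0; apply: inO_1.
by rewrite mulnS exprS; apply: inO_mul.
Qed.

Lemma inO_1B f : inO 0 f -> inO 0 (1 - f).
Proof. by move=> Of; apply: inO_add inO_1 (inO_opp Of). Qed.

Lemma cong_refl M f : cong M f f.
Proof. by rewrite /cong subrr; apply: inO_0. Qed.

Lemma cong_sym M f g : cong M f g -> cong M g f.
Proof. by move=> /inO_opp; rewrite opprB. Qed.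

Lemma cong_trans M g f h : cong M f g -> cong M g h -> cong M f h.
Proof. by move=> fg gh; have := inO_add fg gh; rewrite addrA subrK. Qed.

(** The field also contains elements outside the ring, so the cofactors [g] and [f'] of the two
    differences must be known to lie in it. *)
Lemma cong_mul M f g f' g' : inO 0 g -> inO 0 f' ->
  cong M f f' -> cong M g g' -> cong M (f * g) (f' * g').
Proof.
move=> Og Of' ff gg; rewrite /cong.
have -> : f * g - f' * g' = (f - f') * g + f' * (g - g') by ring.
apply: inO_add; first by rewrite -[M]addn0; apply: inO_mul.
exact: (@inO_mul 0).
Qed.

Lemma cong1_inO M f : cong M f 1 -> inO 0 f.
Proof.
by move=> /(inO_weak (leq0n _)) fO; rewrite -(subrK 1 f); apply: inO_add inO_1.
Qed.

Lemma cong_inO M f g : cong M f g -> inO 0 g -> inO 0 f.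
Proof.
by move=> /(inO_weak (leq0n _)) fO Og; rewrite -(subrK g f); apply: inO_add Og.
Qed.

Lemma cong_mulr M f g h : inO 0 h -> cong M f g -> cong M (f * h) (g * h).
Proof.
by move=> Oh fg; rewrite /cong -mulrBl -[M]addn0; apply: inO_mul.
Qed.

Lemma cong_prod M I (s : seq I) (P : pred I) (F G : I -> K) :
  (forall i, P i -> inO 0 (G i)) -> (forall i, P i -> cong M (F i) (G i)) ->
  cong M (\prod_(i <- s | P i) F i) (\prod_(i <- s | P i) G i).
Proof.
move=> OG FG.
suff [] : cong M (\prod_(i <- s | P i) F i) (\prod_(i <- s | P i) G i) /\
          inO 0 (\prod_(i <- s | P i) G i) by [].
apply: (big_ind2 (fun f g => cong M f g /\ inO 0 g)).
- by split; [apply: cong_refl | apply: inO_1].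
- move=> f f' g g' [ff Of'] [gg Og']; split; last exact: inO_mul0.
  by apply: cong_mul => //; apply: cong_inO Og'; exact: gg.
- by move=> i Pi; split; [apply: FG | apply: OG].
Qed.

Lemma cong_prod1 M I (s : seq I) (P : pred I) (F : I -> K) :
  (forall i, P i -> cong M (F i) 1) -> cong M (\prod_(i <- s | P i) F i) 1.
Proof.
move=> F1; have e1 : \prod_(i <- s | P i) (1 : K) = 1 by rewrite big1.
by rewrite -[X in cong _ _ X]e1; apply: cong_prod F1 => // i _; apply: inO_1.
Qed.

Definition gsum (w : K) T : K := \sum_(j < T) w ^+ j.

Lemma cong_gsum_inv w T : inO 1 w -> cong T ((1 - w) * gsum w T) 1.
Proof.
move=> Ow; rewrite /cong.
have -> : (1 - w) * gsum w T - 1 = - w ^+ T.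
  have -> : (1 - w) * gsum w T - 1 = - ((w - 1) * gsum w T) - 1 by ring.
  by rewrite /gsum -subrX1; ring.
by apply: inO_opp; rewrite -[X in inO X]mul1n; apply: inO_expM.
Qed.

Lemma cong_gsum_1 M w T : inO M w -> (0 < T)%N -> cong M (gsum w T) 1.
Proof.
case: T => // T Ow _; rewrite /cong /gsum big_ord_recl expr0 addrC addKr.
apply: inO_sum => i _; rewrite /= /bump leq0n add1n exprS -[M]addn0.
by apply: inO_mul => //; apply: inO_exp; apply: inO_weak Ow.
Qed.

(** The numerator has the factors 1 - q^j u for 1 <= j <= T, the truncated inverses those for k <= j
    < T + k. The common range cancels modulo q^T, inverses with j > T are 1 modulo q^T, and j < k
    remains. *)
Lemma cong_pair u k T : inO 0 u -> (0 < k <= T)%N ->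
  cong T ((\prod_(l < T) (1 - q * u * q ^+ l)) *
          \prod_(l < T) gsum (q ^+ k * u * q ^+ l) T)
         (\prod_(l < k.-1) (1 - q ^+ l.+1 * u)).
Proof.
case: k => // k Ou /= kT; pose v l := q ^+ l.+1 * u.
have Ov l : inO l.+1 (v l) by rewrite -[l.+1]addn0; apply: inO_mul => //; apply: inO_q.
have -> : \prod_(l < T) (1 - q * u * q ^+ l) =
   (\prod_(l < k) (1 - v l)) * \prod_(l < T - k) (1 - v (l + k)%N).
  transitivity (\prod_(0 <= l < T) (1 - v l)).
    by rewrite big_mkord; apply: eq_bigr => l _; rewrite /v exprS; congr (1 - _); ring.
  by rewrite (big_cat_nat (n := k)) ?(ltnW kT) //= -{2}[k]add0n big_addn !big_mkord.
have -> : \prod_(l < T) gsum (q ^+ k.+1 * u * q ^+ l) T =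
   (\prod_(l < T - k) gsum (v (l + k)%N) T) * \prod_(l < k) gsum (v (l + T)%N) T.
  transitivity (\prod_(0 <= l < T) gsum (v (l + k)%N) T).
    rewrite big_mkord; apply: eq_bigr => l _; congr (gsum _ _).
    by rewrite /v -addnS exprD; ring.
  rewrite (big_cat_nat (n := T - k)) ?leq_subr //= -{2}[(T - k)%N]add0n big_addn.
  rewrite subKn ?(ltnW kT) // !big_mkord; congr (_ * _); apply: eq_bigr => l _.
  by congr (gsum (v _) _); lia.
rewrite mulrA -(mulrA (\prod_(l < k) _)) -big_split /=.
rewrite -[X in cong _ _ X]mulr1 -[X in cong _ _ X]mulr1.
have O1 : cong T (\prod_(l < k) gsum (v (l + T)%N) T) 1.
  apply: cong_prod1 => l _; apply: cong_gsum_1; last lia.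
  by apply: inO_weak (Ov _); lia.
have OP : inO 0 (\prod_(l < k) (1 - v l)).
  by apply: inO_prod => l _; apply/inO_1B/(inO_weak _ (Ov l)).
have O2 : cong T (\prod_(l < T - k) ((1 - v (l + k)%N) * gsum (v (l + k)%N) T)) 1.
  by apply: cong_prod1 => l _; apply: cong_gsum_inv; apply: inO_weak (Ov _).
apply: cong_mul => //; [exact: cong1_inO O1 | by rewrite mulr1|].
by apply: cong_mul => //; [exact: cong1_inO O2 | exact: cong_refl].
Qed.

Lemma io_qpi B e : io (qpi 'X B e)%:MP = \prod_(e <= l < B) (1 - q ^+ l).
Proof.
rewrite /qpi !rmorph_prod; apply: eq_bigr => l _ /=.
by rewrite mpolyCB mpolyC1 rmorphB rmorph1 /qK -!rmorphXn.
Qed.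

(** The surplus factors 1 - q^l of [qpi] have l >= e + T >= M. *)
Lemma cong_qpi M T B e : (M <= e + T)%N -> (e + T <= B)%N ->
  cong M (\prod_(l < T) (1 - q ^+ e * q ^+ l)) (io (qpi 'X B e)%:MP).
Proof.
move=> MT TB; rewrite io_qpi (big_cat_nat (n := e + T)) ?leq_addr //=.
have -> : \prod_(e <= l < e + T) (1 - q ^+ l) = \prod_(l < T) (1 - q ^+ e * q ^+ l).
  rewrite -{1}[e]add0n big_addn addKn big_mkord.
  by apply: eq_bigr => l _; rewrite addnC exprD.
rewrite -[X in cong _ X]mulr1; apply: cong_mul.
- exact: inO_1.
- apply: inO_prod => l _; apply: inO_1B; rewrite -exprD.
  by apply: inO_weak (inO_q _).
- exact: cong_refl.
apply: cong_sym; rewrite big_seq_cond; apply: cong_prod1 => l /andP[].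
rewrite mem_index_iota => /andP[le _] _; rewrite /cong addrAC subrr sub0r.
by apply/inO_opp/inO_weak/inO_q; apply: leq_trans le.
Qed.

Lemma cong_qpi_inv T B e : (0 < e)%N -> (e + T <= B)%N ->
  cong T (io (qpi 'X B e)%:MP * \prod_(l < T) gsum (q ^+ e * q ^+ l) T) 1.
Proof.
move=> e0 TB.
have Ow l : inO 1 (q ^+ e * q ^+ l).
  by rewrite -exprD; apply: inO_weak (inO_q _); rewrite addn_gt0 e0.
have OG : inO 0 (\prod_(l < T) gsum (q ^+ e * q ^+ l) T).
  by apply: inO_prod => l _; apply: inO_sum => j _; apply/inO_exp/inO_weak/Ow.
apply: cong_trans (cong_mulr OG (cong_sym (cong_qpi _ TB))) _; first exact: leq_addl.
by rewrite -big_split; apply: cong_prod1 => l _; apply: cong_gsum_inv.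
Qed.

Lemma wcoef_cong k (p : lpoly n) M f s P (mu : 'X_{1..n}) (lam : {ffun 'I_n -> int}) (c : nat) :
  (forall t, t \in p -> 0 <= weight k t.2) -> cong M (ev io k p) f ->
  f * io (XX n) ^+ s = io P -> (forall i, lam i + s%:Z = (mu i)%:Z) -> (c < M)%N ->
  wcoef k p c lam = P@_mu`_c.
Proof.
move=> wp [s' [P' hE]] fE lamE cM.
have evE : ev io k p * io (XX n) ^+ (s + s') =
    io (P * XX n ^+ s' + ('X ^+ M)%:MP * P' * XX n ^+ s).
  rewrite rmorphD rmorphM -fE [io (_ * _ * _)]rmorphM -hE !rmorphXn exprD.
  by ring.
rewrite (@wcoefE n K io io_inj k p _ _ ([multinom s' | i < n] + mu)%MM lam c wp evE).
  rewrite mcoeffD XXE mcoeffMX coefD -mulrA mcoeffCM coefXnM cM.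
  by rewrite addr0.
by move=> i; rewrite mnmDE mnmE PoszD addrA lamE addrC.
Qed.

End Congruence.

(** * The left-hand side at z = q^k *)

Section Approximants.

Context (N : nat) (K : fieldType) (io : {rmorphism {mpoly {poly int}[N.+2]} -> K}).
Context (io_inj : injective io).
Context (k u : nat) (m : int).
Context (kmu : k%:Z - m = u%:Z).
Context (u2k : (u < 2 * k)%N).

Local Notation q := (qK io).
Local Notation x := (xK io).
Local Notation ev := (ev io k).

Let k_gt0 : (0 < k)%N.
Proof. by case: k u2k. Qed.

Lemma evm_xij a b (i j : 'I_N.+2) :
  evm io k (a, b, xij i j) = q ^ (b + a * k%:Z) * (x i / x j).
Proof.
rewrite /evm /weight /=; congr (_ * _).
have delta (c : 'I_N.+2) (s : int) : \prod_l x l ^ ((l == c)%:Z * s) = x c ^ s.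
  rewrite (bigD1 c) //= eqxx mul1r big1 ?mulr1 // => l /negPf ->.
  by rewrite mul0r expr0z.
rewrite -[x i]expr1z -(delta i 1) -[(x j)^-1]exprN1 -(delta j (-1)) -big_split /=.
apply: eq_bigr => l _; rewrite ffunE -expfzDr ?xK_neq0 //.
by rewrite mulr1 mulrN1.
Qed.

Lemma prod_offdiag (F : 'I_N.+2 -> 'I_N.+2 -> K) :
  \prod_(p <- offdiag_pairs N.+2) F p.1 p.2 = \prod_i \prod_(j | j != i) F i j.
Proof.
rewrite /offdiag_pairs big_filter big_mkcond big_allpairs_dep /= big_enum /=.
apply: eq_bigr => i _; rewrite big_enum /= [RHS]big_mkcond /=.
by apply: eq_bigr => j _; rewrite eq_sym.
Qed.

Lemma prod_ltpairs (F : 'I_N.+2 -> 'I_N.+2 -> K) :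
  \prod_(p <- lt_pairs N.+2) F p.1 p.2 = \prod_(i < N.+2) \prod_(j < N.+2 | (i < j)%N) F i j.
Proof.
rewrite /lt_pairs big_filter big_mkcond big_allpairs_dep /= big_enum /=.
by apply: eq_bigr => i _; rewrite big_enum /= [RHS]big_mkcond.
Qed.

Definition g_fin : K :=
  (\prod_i x i ^ (- m)) *
  (\prod_(i < N.+2) \prod_(j < N.+2 | j != i) \prod_(l < k.-1) (1 - q ^+ l.+1 * (x i / x j))) *
  \prod_(i < N.+2) \prod_(j < N.+2 | (i < j)%N) (x i - x j).

Lemma inO_xz i (s : int) : inO io 0 (x i ^ s).
Proof.
case: s => s; first exact/inO_exp/inO_x.
by rewrite NegzE -exprnN -exprVn; apply/inO_exp/inO_xV.
Qed.

Lemma cong_g T : (k <= T)%N -> cong io T (ev (g_approx N.+2 m T)) g_fin.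
Proof.
move=> kT; rewrite /g_approx ev_prod // !big_cons big_nil mulr1 ev_mon.
rewrite (evm_xexp io k) mul1r.
have -> : \prod_i x i ^ [ffun=> - m] i = \prod_i x i ^ (- m).
  by apply: eq_bigr => i _; rewrite ffunE.
rewrite !ev_prod_map // (prod_offdiag (fun i j => ev (poch (0, 1, xij i j) (qb N.+2) T))).
rewrite (prod_offdiag (fun i j => ev (ipoch (1, 0, xij i j) (qb N.+2) T T))).
rewrite (prod_ltpairs (fun i j => ev (ladd (lmon 1 (xexp (xi i))) (lmon (-1) (xexp (xi j)))))).
have -> : \prod_(i < N.+2) \prod_(j < N.+2 | (i < j)%N)
     ev (ladd (lmon 1 (xexp (xi i))) (lmon (-1) (xexp (xi j)))) =
   \prod_(i < N.+2) \prod_(j < N.+2 | (i < j)%N) (x i - x j).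
  apply: eq_bigr => i _; apply: eq_bigr => j _.
  have xE (c : 'I_N.+2) : evm io k (xexp (xi c)) = x c.
    rewrite evm_xexp (bigD1 c) //= ffunE eqxx expr1z big1 ?mulr1 // => l /negPf lc.
    by rewrite ffunE lc expr0z.
  by rewrite ev_add !ev_mon !xE mul1r mulN1r.
have AC (a b c d : K) : a * (b * (c * d)) = b * c * a * d by ring.
rewrite AC /g_fin; apply: cong_mulr.
  apply: inO_prod => i _; apply: inO_prod => j _.
  by apply: inO_add; [apply: inO_x|apply/inO_opp/inO_x].
rewrite [X in cong _ _ _ X]mulrC; apply: cong_mulr.
  by apply: inO_prod => i _; apply: inO_xz.
rewrite -big_split; apply: cong_prod => i _.
  apply: inO_prod => j _; apply: inO_prod => l _; apply/inO_1B/inO_mul0.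
    exact: inO_weak (inO_q _ _).
  by apply: inO_mul0; [apply: inO_x|apply: inO_xV].
rewrite /= -big_split; apply: cong_prod => j _.
  apply: inO_prod => l _; apply/inO_1B/inO_mul0; first exact: inO_weak (inO_q _ _).
  by apply: inO_mul0; [apply: inO_x|apply: inO_xV].
rewrite /= ev_poch // ev_ipoch // !evm_xij evm_zq mul0r addr0 mul1r add0r expr1z.
apply: cong_pair => //; last by rewrite k_gt0.
by apply: inO_mul0; [apply: inO_x|apply: inO_xV].
Qed.

(** In the exponent [s], the summand [m] undoes x^(-m); the other clears denominators, since each
    x_j divides in N + 1 pairs with k - 1 factors each. *)
Lemma g_fin_Psi (s : nat) : s%:Z = m + (N.+1 * k.-1)%N%:Z ->
  g_fin * io (XX N.+2) ^+ s = io (PsiX 'X k N.+2).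
Proof.
move=> sE; rewrite /PsiX (rmorph_Psi io) /=.
have -> : io (XX N.+2) ^+ s = (\prod_i x i ^ m) * \prod_(i < N.+2) \prod_(j < N.+2 | j != i) x j ^+ k.-1.
  have -> : \prod_(i < N.+2) \prod_(j < N.+2 | j != i) x j ^+ k.-1 =
       \prod_(j < N.+2) x j ^+ (N.+1 * k.-1).
    rewrite (exchange_big_dep predT) //=; apply: eq_bigr => j _.
    rewrite prodr_const mulnC exprM; congr (_ ^+ _).
    by rewrite (@eq_card _ _ (predC1 j)) ?cardC1 ?card_ord // => i; rewrite !inE eq_sym.
  rewrite -big_split /= rmorph_prod -prodrXl; apply: eq_bigr => i _.
  by rewrite exprnP sE expfzDr ?xK_neq0.
rewrite /g_fin /Psi.
have -> : \prod_(i < N.+2) \prod_(j < N.+2 | (i < j)%N) pairf (io 'X%:MP) k (io 'X_i) (io 'X_j) =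
  (\prod_(i < N.+2) \prod_(j < N.+2 | (i < j)%N) (x i - x j)) *
  \prod_(i < N.+2) \prod_(j < N.+2 | j != i) \prod_(l < k.-1) (x j - q ^+ l.+1 * x i).
  rewrite -prod_ltgt -big_split; apply: eq_bigr => i _ /=.
  rewrite -big_split; apply: eq_bigr => j _ /=.
  by rewrite /pairf big_split.
have e1 : (\prod_i x i ^ (- m)) * (\prod_i x i ^ m) = 1.
  rewrite -big_split big1 //= => i _.
  by rewrite -expfzDr ?xK_neq0 // addNr.
have e2 : (\prod_(i < N.+2) \prod_(j < N.+2 | j != i) \prod_(l < k.-1) (1 - q ^+ l.+1 * (x i / x j))) *
    (\prod_(i < N.+2) \prod_(j < N.+2 | j != i) x j ^+ k.-1) =
   \prod_(i < N.+2) \prod_(j < N.+2 | j != i) \prod_(l < k.-1) (x j - q ^+ l.+1 * x i).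
  rewrite -big_split; apply: eq_bigr => i _; rewrite -big_split; apply: eq_bigr => j _ /=.
  rewrite -[X in _ ^+ X]card_ord -prodr_const -big_split; apply: eq_bigr => l _ /=.
  by rewrite mulrBl mul1r -!mulrA mulVf ?mulr1 ?xK_neq0.
rewrite -e2; set A := \prod_i x i ^ (- m) in e1 *; set B := \prod_i x i ^ m in e1 *.
set C := \prod_(i < N.+2) _; set D := \prod_(i < N.+2) _; set F := \prod_(i < N.+2) _.
transitivity ((A * B) * (D * (C * F))); first by ring.
by rewrite e1 mul1r.
Qed.

End Approximants.

(** * The right-hand side at z = q^k *)

Lemma polyX_sub1_neq0 j : (0 < j)%N -> 1 - 'X ^+ j != 0 :> {poly int}.
Proof.
move=> j0; rewrite subr_eq0 eq_sym; apply/eqP => /(congr1 (size \o val)) /=.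
by rewrite size_polyXn size_poly1 => -[] /eqP; rewrite eqn0Ngt j0.
Qed.

Lemma fact_poly_neq0 j : j`!%:R != 0 :> {poly int}.
Proof. by rewrite -(rmorph_nat (@polyC int)) polyC_eq0 pnatr_eq0 -lt0n fact_gt0. Qed.

(** The second hypothesis says t = m (m-1) / 2, so the division by 2 is exact. *)
Lemma divz2_exact (k u E t : nat) (m : int) : k%:Z - m = u%:Z ->
  ('C(k, 2) + 'C(u.+1, 2) = k * u + t)%N ->
  divz (E%:Z * m * (m - 1)) 2 = (E * t)%N%:Z.
Proof.
move=> kmu tE; have -> : E%:Z * m * (m - 1) = (E * t)%N%:Z * 2; last by rewrite mulzK.
have C2 j : ('C(j, 2) * 2 + j = j * j)%N.
  by elim: j => // j IH; rewrite binS bin1; nia.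
have mE : m = k%:Z - u%:Z by rewrite -kmu; ring.
have := C2 k; have := C2 u.+1; rewrite mE; move: ('C(k, 2)) ('C(u.+1, 2)) tE => a b; nia.
Qed.

Lemma signz_parity (k u E : nat) (m : int) : k%:Z - m = u%:Z ->
  (-1) ^ (E%:Z * m) = (-1) ^+ (E * (k + u)) :> int.
Proof.
move=> kmu; have -> : E%:Z * m = (E * (k + u))%N%:Z + 2 * (- (E * u)%N%:Z).
  have -> : m = k%:Z - u%:Z by rewrite -kmu; ring.
  by rewrite !PoszM PoszD; ring.
by rewrite exprzDr ?unitrN1 // -exprz_exp -[(-1) ^ 2]/(1 : int) exp1rz mulr1.
Qed.

Section RightHandSide.

Context (N : nat) (K : fieldType) (io : {rmorphism {mpoly {poly int}[N.+2]} -> K}).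
Context (io_inj : injective io).
Context (k u : nat) (m : int).
Context (kmu : k%:Z - m = u%:Z).
Context (u2k : (u < 2 * k)%N).

Local Notation q := (qK io).
Local Notation ev := (ev io k).

Let k_gt0 : (0 < k)%N.
Proof. by case: k u2k. Qed.

Let P T e := \prod_(l < T) (1 - q ^+ e * q ^+ l).
Let G T e := \prod_(l < T) gsum (q ^+ e * q ^+ l) T.

Lemma ev_poch_zq T a b (e : nat) : b + a * k%:Z = e%:Z ->
  ev (poch (zq N.+2 a b) (qb N.+2) T) = P T e.
Proof. by move=> eE; rewrite ev_poch // !evm_zq eE mul0r addr0 expr1z. Qed.

Lemma ev_ipoch_zq T a b (e : nat) : b + a * k%:Z = e%:Z ->
  ev (ipoch (zq N.+2 a b) (qb N.+2) T T) = G T e.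
Proof. by move=> eE; rewrite ev_ipoch // !evm_zq eE mul0r addr0 expr1z. Qed.

Lemma ev_nseq j p : ev (lprod (nseq j p)) = ev p ^+ j.
Proof. by rewrite ev_prod //; elim: j => [|j IH]; rewrite ?big_nil // big_cons IH exprS. Qed.

(** [coefA_closed] is an exact identity, coefficient times denominator against numerator. Modulo q^T
    the truncated inverses [H] invert the denominator and the truncated products agree with the
    numerator, so no quotient is ever formed. *)
Lemma cong_rhs T : cong io T (ev (rhs_approx N.+2 m T)) (io (coefA 'X k N.+1 u)%:MP).
Proof.
have [t tE] : exists t, ('C(k, 2) + 'C(u.+1, 2) = k * u + t)%N.
  have C2 j : ('C(j, 2) * 2 + j = j * j)%N.
    by elim: j => // j IH; rewrite binS bin1; nia.
  exists ('C(k, 2) + 'C(u.+1, 2) - k * u)%N; rewrite subnKC //.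
  have := C2 k; have := C2 u.+1; move: ('C(k, 2)) ('C(u.+1, 2)) => a b.
  by have := sqr_ge0 (k%:Z - u%:Z); nia.
(* All starting indices are at most [N.+4.+1 * k], so each product of length [T] ends below [B]. *)
pose B := (N.+4.+1 * k + T)%N.
have kB : (N.+4 * k < B)%N by rewrite /B; have := k_gt0; nia.
have q1 := polyX_sub1_neq0.
pose qp e := io (qpi 'X B e)%:MP.
pose s : K := (-1) ^+ (N.+1 * (k + u)) * q ^+ (N.+1 * t).
pose H := G T 1 ^+ N * G T (1 + k * N.+1) *
   (\prod_(l < N.+1) gsum (q ^+ k * (q ^+ k) ^+ l) T) *
   \prod_(i < N.+1) (G T (k * i.+2) * G T (k * i + 1)).
have evE : ev (rhs_approx N.+2 m T) =
   s * (P T k ^+ N.+1 * \prod_(i < N.+1) (P T (k * i + 1 + u) * P T (k * i.+2 - u))) * H.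
  rewrite /rhs_approx ev_prod // !big_cons big_nil mulr1 ev_mon evm_zq !ev_nseq.
  rewrite (signz_parity _ kmu) (divz2_exact _ kmu tE) mul0r addr0 -exprnP.
  rewrite (@ev_poch_zq T 1 0 k); last by rewrite mul1r add0r.
  rewrite (@ev_ipoch_zq T 0 1 1); last by rewrite mul0r addr0.
  rewrite (@ev_ipoch_zq T _ 1 (1 + k * N.+1)); last by rewrite PoszD PoszM mulrC.
  rewrite ev_ipoch // evm_zq mul1r add0r -exprnP.
  rewrite ev_prod_map // -/(index_iota 1 N.+2) big_add1 big_mkord.
  have -> : \prod_(i < N.+2.-1) ev (lprod [:: poch (zq N.+2 i.+1%:Z (1 - m)) (qb N.+2) T;
        poch (zq N.+2 i.+1%:Z m) (qb N.+2) T; ipoch (zq N.+2 i.+2%:Z 0) (qb N.+2) T T;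
        ipoch (zq N.+2 i.+1.-1%:Z 1) (qb N.+2) T T]) =
     (\prod_(i < N.+1) (P T (k * i + 1 + u) * P T (k * i.+2 - u))) *
     \prod_(i < N.+1) (G T (k * i.+2) * G T (k * i + 1)).
    rewrite -big_split; apply: eq_bigr => i _; rewrite [RHS]/=.
    have mE : m = k%:Z - u%:Z by rewrite -kmu; ring.
    rewrite ev_prod // !big_cons big_nil mulr1.
    rewrite (@ev_poch_zq T _ _ (k * i + 1 + u)); last by rewrite mE; lia.
    rewrite (@ev_poch_zq T _ _ (k * i.+2 - u)); last by rewrite mE; nia.
    rewrite (@ev_ipoch_zq T _ _ (k * i.+2)); last by lia.
    rewrite (@ev_ipoch_zq T _ _ (k * i + 1)); last by lia.
    by ring.
  rewrite rmorphXn rmorphN1 subn2 /= /s /H.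
  by rewrite -![\prod_(l < N.+1) \sum_(j < T) _]/(\prod_(l < N.+1) gsum _ T); ring.
have Tle e : (e <= N.+4.+1 * k)%N -> (e + T <= B)%N by rewrite /B leq_add2r.
have OG e : (0 < e)%N -> inO io 0 (G T e).
  move=> e0; apply: inO_prod => l _; apply: inO_sum => j _; apply: inO_exp.
  by rewrite -exprD; apply: inO_weak (inO_q _ _).
have OP e : inO io 0 (P T e).
  by apply: inO_prod => l _; apply: inO_1B; rewrite -exprD; apply: inO_weak (inO_q _ _).
have Oz : inO io 0 (\prod_(l < N.+1) gsum (q ^+ k * (q ^+ k) ^+ l) T).
  apply: inO_prod => l _; apply: inO_sum => j _; apply: inO_exp.
  by rewrite -exprM -exprD; apply: inO_weak (inO_q _ _).
have OH : inO io 0 H.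
  rewrite /H; apply: inO_mul0.
    by apply: inO_mul0 => //; apply: inO_mul0; [apply/inO_exp/OG | apply: OG].
  by apply: inO_prod => i _; apply: inO_mul0; apply: OG; rewrite ?addn1 // muln_gt0 k_gt0.
have GI e : (0 < e <= N.+4.+1 * k)%N -> cong io T (qp e * G T e) 1.
  by move=> /andP[e0 ek]; apply: cong_qpi_inv => //; apply: Tle.
have PI e : (e <= N.+4.+1 * k)%N -> cong io T (P T e) (qp e).
  by move=> ek; apply: cong_qpi; [apply: leq_addl | apply: Tle].
have ioprod (F : 'I_N.+1 -> {poly int}) : io (\prod_i F i)%:MP = \prod_i io (F i)%:MP.
  by rewrite !rmorph_prod.
have ioX (f : {poly int}) j : io (f ^+ j)%:MP = (io f%:MP) ^+ j by rewrite !rmorphXn.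
have denH : cong io T (io (coefA_den 'X k N.+1 B)%:MP * H) 1.
  have -> : io (coefA_den 'X k N.+1 B)%:MP * H =
    (\prod_(i < N) (qp 1 * G T 1)) * (qp (1 + k * N.+1) * G T (1 + k * N.+1)) *
    (\prod_(i < N.+1) ((1 - q ^+ k * (q ^+ k) ^+ i) * gsum (q ^+ k * (q ^+ k) ^+ i) T)) *
    (\prod_(i < N.+1) ((qp (k * i.+2) * G T (k * i.+2)) * (qp (k * i + 1) * G T (k * i + 1)))).
    rewrite /coefA_den !mpolyCM 3!rmorphM !ioprod ioX /= prodr_const card_ord exprMn /H.
    have -> : \prod_(i < N.+1) io (1 - 'X ^+ (k * i.+1))%:MP =
       \prod_(i < N.+1) (1 - q ^+ k * (q ^+ k) ^+ i).
      apply: eq_bigr => i _; rewrite -exprM -exprD -mulnS.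
      by rewrite mpolyCB mpolyC1 rmorphB rmorph1 /qK -!rmorphXn.
    have -> : \prod_(i < N.+1) io (qpi 'X B (k * i.+2) * qpi 'X B (k * i + 1))%:MP =
       \prod_(i < N.+1) (qp (k * i.+2) * qp (k * i + 1)).
      by apply: eq_bigr => i _; rewrite mpolyCM rmorphM.
    by rewrite -/(qp 1) -/(qp _) !big_split /=; ring.
  have congM1 f g : cong io T f 1 -> cong io T g 1 -> cong io T (f * g) 1.
    move=> f1 g1; rewrite -[X in cong _ _ _ X]mulr1.
    by apply: cong_mul => //; [apply: cong1_inO g1 | apply: inO_1].
  apply: (congM1 _ _); [apply: (congM1 _ _); [apply: (congM1 _ _)|]|].
  - by apply: cong_prod1 => i _; apply: GI; have := k_gt0; nia.
  - by apply: GI; have := k_gt0; nia.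
  - apply: cong_prod1 => i _; apply: cong_gsum_inv; rewrite -exprM -exprD.
    by apply: inO_weak (inO_q _ _); rewrite addn_gt0 k_gt0.
  - apply: cong_prod1 => i _; apply: congM1; apply: GI; have := ltn_ord i; have := k_gt0; nia.
have numE : io (coefA 'X k N.+1 u)%:MP * io (coefA_den 'X k N.+1 B)%:MP =
    s * io (coefA_num 'X k N.+1 B u)%:MP.
  have qX : q ^+ (N.+1 * k * u) != 0 by rewrite expf_neq0 // qK_neq0.
  apply: (mulfI qX); have X0 : 'X != 0 :> {poly int} by rewrite polyX_eq0.
  have := coefA_closed X0 q1 (fact_poly_neq0 N.+1) k_gt0 kB u2k.
  move=> /(congr1 (fun p => io p%:MP)); rewrite !mpolyCM !rmorphM tE.
  have ioXq j : io ('X ^+ j)%:MP = q ^+ j by rewrite ioX.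
  rewrite !ioXq -mulrA => ->.
  have -> : (N.+1 * (k * u + t) = N.+1 * k * u + N.+1 * t)%N by nia.
  have -> : io ((-1) ^+ (N.+1 * (k + u)))%:MP = (-1) ^+ (N.+1 * (k + u)).
    by rewrite !rmorphXn /= !rmorphN1.
  by rewrite /s exprD; ring.
have numP : cong io T (P T k ^+ N.+1 *
     \prod_(i < N.+1) (P T (k * i + 1 + u) * P T (k * i.+2 - u)))
   (io (coefA_num 'X k N.+1 B u)%:MP).
  have -> : io (coefA_num 'X k N.+1 B u)%:MP = (\prod_(i < N.+1) qp k) *
      \prod_(i < N.+1) (qp (k * i + 1 + u)%N * qp (k * i.+2 - u)%N).
    rewrite /coefA_num mpolyCM rmorphM ioprod ioX prodr_const card_ord.
    by congr (_ * _); apply: eq_bigr => i _; rewrite mpolyCM rmorphM.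
  have -> : P T k ^+ N.+1 = \prod_(i < N.+1) P T k by rewrite prodr_const card_ord.
  rewrite -!big_split; apply: cong_prod => i _ /=.
    by apply: inO_mul0; [apply: inO_io | apply: inO_mul0; apply: inO_io].
  have := ltn_ord i; have := k_gt0 => k0 iN.
  apply: cong_mul; [exact: inO_mul0 | exact: inO_io | apply: PI; nia |].
  by apply: cong_mul; [done | exact: inO_io | apply: PI; nia | apply: PI; nia].
have Os : inO io 0 s.
  apply: inO_mul0; last exact: inO_weak (inO_q _ _).
  by apply/inO_exp/inO_opp/inO_1.
rewrite evE; apply: (@cong_trans _ _ _ _ (s * io (coefA_num 'X k N.+1 B u)%:MP * H)).
  apply: cong_mulr => //; rewrite mulrC [s * _]mulrC; exact: cong_mulr.
rewrite -numE -mulrA -[X in cong _ _ _ X]mulr1 mulrC [X in cong _ _ _ X]mulrC.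
by apply: cong_mulr => //; apply: inO_io.
Qed.

End RightHandSide.

(** * Interpolation *)

(* The negative q-exponents of the right-hand side come with powers of z, which
   is why the bound on them is linear in the z-exponent. *)
Definition egood (c : nat) n (e : expo n) : bool :=
  (0 <= e.1.1) && (0 <= e.1.2 + e.1.1 * c%:Z).

Definition lgood c n (p : lpoly n) : bool := all (fun t => egood c t.2) p.

Section Good.

Context (c n : nat).
Implicit Types (e f u b w : expo n) (p r : lpoly n).

Lemma egood_add e f : egood c e -> egood c f -> egood c (eadd e f).
Proof.
move=> /andP[e1 e2] /andP[f1 f2]; apply/andP; split; first exact: addr_ge0.
by have := addr_ge0 e2 f2; rewrite mulrDl addrACA.
Qed.

Lemma egood0 : egood c (ezero n).
Proof. by rewrite /egood /= mul0r addr0 lexx. Qed.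

Lemma egood_scale j e : egood c e -> egood c (escale j e).
Proof.
move=> ge; elim: j => [|j IH]; first by rewrite escale0 egood0.
by rewrite escaleS; apply: egood_add.
Qed.

Lemma lgood_mon a e : egood c e -> lgood c (lmon a e).
Proof. by rewrite /lgood /= => ->. Qed.

Lemma lgood_add p r : lgood c p -> lgood c r -> lgood c (ladd p r).
Proof. by rewrite /lgood all_cat => -> ->. Qed.

Lemma lgood_mul p r : lgood c p -> lgood c r -> lgood c (lmul p r).
Proof.
move=> /allP gp /allP gr; apply/allP => t /allpairsP[[s1 s2] /= [s1p s2r ->]] /=.
by apply: egood_add; [apply: gp | apply: gr].
Qed.

Lemma lgood_nil : lgood c (lprod (@nil (lpoly n))).
Proof. by apply: lgood_mon; apply: egood0. Qed.

Lemma lgood_cons p (ps : seq (lpoly n)) :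
  lgood c p -> lgood c (lprod ps) -> lgood c (lprod (p :: ps)).
Proof. exact: lgood_mul. Qed.

Lemma lgood_prod_map (I : Type) (s : seq I) (F : I -> lpoly n) :
  (forall i, lgood c (F i)) -> lgood c (lprod [seq F i | i <- s]).
Proof.
move=> gF; elim: s => [|i s IH]; first exact: lgood_nil.
by rewrite map_cons; apply: lgood_cons.
Qed.

Lemma lgood_poch u b T : egood c u -> egood c b -> lgood c (poch u b T).
Proof.
move=> gu gb; apply: lgood_prod_map => l; apply: lgood_add; apply: lgood_mon.
  exact: egood0.
by apply: egood_add => //; apply: egood_scale.
Qed.

Lemma lgood_geom w T : egood c w -> lgood c (geom w T).
Proof.
move=> gw; rewrite /geom /lsum; elim: (iota 0 T) => //= j s IH.
by rewrite egood_scale.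
Qed.

Lemma lgood_ipoch u b C T : egood c u -> egood c b -> lgood c (ipoch u b C T).
Proof.
move=> gu gb; apply: lgood_prod_map => l; apply: lgood_geom.
by apply: egood_add => //; apply: egood_scale.
Qed.

Lemma lgood_nseq j p : lgood c p -> lgood c (lprod (nseq j p)).
Proof.
by move=> gp; elim: j => [|j IH]; [apply: lgood_nil | apply: lgood_cons].
Qed.

Lemma lgood_weight k p t : (c <= k)%N -> lgood c p -> t \in p -> 0 <= weight k t.2.
Proof.
move=> ck /allP gp /gp /andP[t1 t2]; apply: le_trans t2 _.
by rewrite /weight lerD2l ler_wpM2l // lez_nat.
Qed.

End Good.

Lemma lgood_g n m T : lgood `|m| (g_approx n m T).
Proof.
rewrite /g_approx; do 4?[apply: lgood_cons]; last exact: lgood_nil.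
- by apply: lgood_mon; rewrite /egood /=; lia.
- by apply: lgood_prod_map => p; apply: lgood_poch; rewrite /egood /=; lia.
- by apply: lgood_prod_map => p; apply: lgood_ipoch; rewrite /egood /=; lia.
- by apply: lgood_prod_map => p; apply: lgood_add; apply: lgood_mon; rewrite /egood /=; lia.
Qed.

Lemma lgood_rhs n m T : (1 < n)%N -> lgood `|m| (rhs_approx n m T).
Proof.
move=> n1; have gq : egood `|m| (qb n) by rewrite /egood /=; lia.
have zqgood a b : 0 <= a -> 0 <= b + a * `|m|%N%:Z -> egood `|m| (zq n a b).
  by move=> a0 b0; rewrite /egood /= a0.
have E0 : 0 <= divz (n.-1%:Z * m * (m - 1)) 2.
  by rewrite divz_ge0 // -mulrA; apply: mulr_ge0 => //; nia.
rewrite /rhs_approx; do 6?[apply: lgood_cons]; last exact: lgood_nil.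
- by apply: lgood_mon; apply: zqgood; rewrite ?mul0r ?addr0.
- by apply: lgood_nseq; apply: lgood_poch => //; apply: zqgood; lia.
- by apply: lgood_nseq; apply: lgood_ipoch.
- by apply: lgood_ipoch => //; apply: zqgood; lia.
- by apply: lgood_ipoch => //; apply: zqgood; lia.
(* Only for i > 0 does z^i compensate the negative exponent in q^m or q^(1-m). *)
have : all (leq 1) (iota 1 n.-1) by apply/allP => i; rewrite mem_iota => /andP[].
elim: (iota 1 n.-1) => [|i s IH]; first by move=> _; apply: lgood_nil.
rewrite [all _ _]/= => /andP[i0 /IH{}IH]; rewrite map_cons; apply: lgood_cons => //.
do 4?[apply: lgood_cons]; last exact: lgood_nil.
- by apply: lgood_poch => //; apply: zqgood => //; nia.
- by apply: lgood_poch => //; apply: zqgood => //; nia.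
- by apply: lgood_ipoch => //; apply: zqgood => //; nia.
- by apply: lgood_ipoch => //; apply: zqgood => //; nia.
Qed.

(** A term with z-exponent i > a has weight at least i (k - c) > a k + |b|, so only i <= a
    contribute. *)
Lemma wcoef_sum c n (p : lpoly n) (k a : nat) (b : int) lam :
  lgood c p -> (c + `|b| + c * a < k)%N ->
  wcoef k p (b + (a * k)%N%:Z) lam =
  \sum_(i < a.+1) lcoef p (i%:Z, b + ((a - i) * k)%N%:Z, lam).
Proof.
move=> gp kbig; rewrite /wcoef /lcoef.
under [RHS]eq_bigr do rewrite big_mkcond.
rewrite exchange_big /= big_mkcond !big_seq; apply: eq_bigr => -[x [[al be] l]] tp /=.
have /andP[/= al0 be0] := allP gp _ tp; rewrite /weight /=.
have tE (i : 'I_a.+1) : ((al, be, l) == (i%:Z, b + ((a - i) * k)%N%:Z, lam)) =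
   [&& al == i%:Z, be + al * k%:Z == b + (a * k)%N%:Z & l == lam].
  rewrite -[LHS]/((al == i%:Z) && (be == b + ((a - i) * k)%N%:Z) && (l == lam)) andbA.
  congr (_ && _); case: eqP => //= ->; have := ltn_ord i; nia.
under [RHS]eq_bigr do rewrite tE.
case: (boolP (_ && _)) => [/andP[/eqP e /eqP le]|ne].
  have alE : (`|al| < a.+1)%N by nia.
  rewrite (bigD1 (Ordinal alE)) //= gez0_abs // eqxx /= big1 ?addr0 // => i.
  rewrite -val_eqE /= => ni; case: eqP => // alei.
  by rewrite alei /= eqxx in ni.
by rewrite big1 // => i _; rewrite andbF.
Qed.

(* Every term with z-exponent larger than a is out of reach of the exponent
   b + a k once k is large, so the coefficients are recovered by induction on a. *)
Lemma coef_lim_interpolation c n (F G : nat -> lpoly n) lam mu :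
  (forall T, lgood c (F T)) -> (forall T, lgood c (G T)) ->
  (forall k (d : int), (c < k)%N -> exists N0 v, forall T, (N0 <= T)%N ->
     wcoef k (F T) d lam = v /\ wcoef k (G T) d mu = v) ->
  forall a b : int, exists v, coef_lim F (a, b, lam) v /\ coef_lim G (a, b, mu) v.
Proof.
move=> gF gG FG [] a b; last first.
  have neg p l : lgood c p -> lcoef p (Negz a, b, l) = 0.
    move=> gp; rewrite /lcoef big_seq_cond big1 // => t /andP[tp /eqP te].
    by have /andP[] := allP gp _ tp; rewrite te.
  by exists 0; split; exists 0%N => T _; apply: neg.
suff {b} H : forall b, exists N0 v, forall T, (N0 <= T)%N ->
    lcoef (F T) (a%:Z, b, lam) = v /\ lcoef (G T) (a%:Z, b, mu) = v.
  by have [N0 [v Hv]] := H b; exists v; split; exists N0 => T /Hv[].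
(* The least [k] allowed by [wcoef_sum]. The induction hypothesis covers all q-exponents, since the
   lower terms carry b + (a - i) k, which depends on this [k]. *)
elim/ltn_ind: a => a IH b; pose k := (c + `|b| + c * a).+1.
have ck : (c < k)%N by rewrite /k; lia.
have [N1 [v1 H1]] := FG k (b + (a * k)%N%:Z) ck.
have sums j : (j <= a)%N -> exists N0 v, forall T, (N0 <= T)%N ->
    \sum_(i < j) lcoef (F T) (i%:Z, b + ((a - i) * k)%N%:Z, lam) = v /\
    \sum_(i < j) lcoef (G T) (i%:Z, b + ((a - i) * k)%N%:Z, mu) = v.
  elim: j => [|j IHj] ja.
    by exists 0%N, 0 => T _; rewrite !big_ord0.
  have [M1 [w1 W1]] := IHj (ltnW ja).
  have [M2 [w2 W2]] := IH j ja (b + ((a - j) * k)%N%:Z).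
  exists (maxn M1 M2), (w1 + w2) => T; rewrite geq_max => /andP[/W1[e1 e2] /W2[e3 e4]].
  by rewrite !big_ord_recr /= e1 e2 e3 e4.
have [N2 [v2 H2]] := sums a (leqnn a).
exists (maxn N1 N2), (v1 - v2) => T; rewrite geq_max => /andP[/H1[e1 e2] /H2[e3 e4]].
move: e1 e2; rewrite !(@wcoef_sum c) // !big_ord_recr /= e3 e4 subnn mul0n addr0.
by move=> <- e2; split; [|move: e2 => /addrI ->]; ring.
Qed.

Theorem theorem3p5 (n : nat) (m : int) (hn : (2 <= n)%N) :
  forall a b : int, exists c : int,
    coef_lim (g_approx n m) (a, b, target_x n m) c /\
    coef_lim (rhs_approx n m) (a, b, [ffun=> 0]) c.
Proof.
apply: (@coef_lim_interpolation `|m|) => [T|T|k d mk]; [exact: lgood_g|exact: lgood_rhs|].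
case: d => d; last first.
  have neg p l : lgood `|m| p -> wcoef (n := n) k p (Negz d) l = 0.
    move=> gp; rewrite /wcoef big_seq_cond big1 // => t /and3P[tp /eqP te _].
    by have := lgood_weight (ltnW mk) gp tp; rewrite te.
  by exists 0%N, 0 => T _; rewrite !neg ?lgood_g ?lgood_rhs.
case: n hn => [|[|N]] // _.
pose io : {rmorphism {mpoly {poly int}[N.+2]} -> {fraction {mpoly {poly int}[N.+2]}}} :=
  @tofrac _.
have io_inj : injective io by move=> p r /eqP; rewrite tofrac_eq => /eqP.
(* From |m| < k follow 0 < u < 2 k, the range of the closed form, and the nonnegativity of the shift
   behind [s]. *)
pose u := `|k%:Z - m|%N; have kmu : k%:Z - m = u%:Z by rewrite /u; lia.
have u2k : (u < 2 * k)%N by rewrite /u; lia.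
pose s := `|(m + (N.+1 * k.-1)%N%:Z)%R|%N.
have sE : s%:Z = m + (N.+1 * k.-1)%N%:Z by rewrite /s; nia.
(* [k <= T] is what [cong_g] asks for, and [d < T] lets a congruence modulo q^T determine the
   coefficient of q^d. *)
exists (maxn k d.+1), (coefA 'X k N.+1 u)`_d => T; rewrite geq_max => /andP[kT dT]; split.
  have wg t : t \in g_approx N.+2 m T -> 0 <= weight k t.2.
    exact: lgood_weight (ltnW mk) (lgood_g _ _ _).
  apply: (wcoef_cong io_inj wg (cong_g io_inj m u2k kT) (g_fin_Psi io_inj sE) _ dT).
  move=> i; rewrite ffunE mnmE /vcons sE; case: unliftP => [j ->|->] /=.
    rewrite mul0r subr0; case: j => j /= jN; rewrite /bump leq0n.
    have -> : (N.+2 * k = N * k.-1 + N + 2 * k)%N by nia.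
    have -> : (N.+1 * k.-1 = N * k.-1 + k.-1)%N by rewrite mulSn addnC.
    by move: (N * k.-1)%N => b; lia.
  have mE : m = k%:Z - u%:Z by rewrite -kmu; ring.
  rewrite mE; clear -mk; nia.
rewrite (wcoef_cong io_inj _ (cong_rhs io_inj kmu u2k T) (s := 0) (P := (coefA 'X k N.+1 u)%:MP)
   (mu := 0%MM) _ _ dT).
- by rewrite mcoeffC eqxx mulr1.
- by move=> t; apply: lgood_weight (ltnW mk) (lgood_rhs _ _ _).
- by rewrite expr0 mulr1.
- by move=> i; rewrite ffunE mnm0E.
Qed.
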